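(* In the braided symmetric algebra $\mathcal{A}_m$, assume $i\le j$ and $r<s<t$ (indices in $\{1,\dots,m\}$). The invariants $\Phi^{(i,j)}$ and $\Psi^{(r,s,t)}$ satisfy the following relations. (1) If $i\neq r,s,t$, then $\Phi^{(i,i)}\Psi^{(r,s,t)}=\Psi^{(r,s,t)}\Phi^{(i,i)}$. (2) If $j<r$, or $r<i,j<s$, or $s<i,j<t$, or $t<i$, or ($i<r$ and $t<j$), then $\Phi^{(i,j)}\Psi^{(r,s,t)}=\Psi^{(r,s,t)}\Phi^{(i,j)}$. (3) If $i<j<r<s<t$, then $$\begin{aligned}&q^{-1}\Psi^{(i,j,s)}\Phi^{(r,t)}-q\Phi^{(r,t)}\Psi^{(i,j,s)}+q\Psi^{(i,r,s)}\Phi^{(j,t)}-q^{-1}\Phi^{(j,t)}\Psi^{(i,r,s)}\\&=(q-q^{-1})\left[\Phi^{(s,t)}\Psi^{(i,j,r)}-\Phi^{(i,t)}\Psi^{(j,r,s)}\right]+(q-q^{-1})(q^2+q^{-2})\left[\Phi^{(i,j)}\Psi^{(r,s,t)}-\Phi^{(r,s)}\Psi^{(i,j,t)}\right],\end{aligned}$$ $$\begin{aligned}&q^{-1}\Psi^{(i,r,s)}\Phi^{(j,t)}-q\Phi^{(j,t)}\Psi^{(i,r,s)}+q\Psi^{(i,r,t)}\Phi^{(j,s)}-q^{-1}\Phi^{(j,s)}\Psi^{(i,r,t)}\\&=(q-q^{-1})\left[\Phi^{(i,j)}\Psi^{(r,s,t)}-\Phi^{(j,r)}\Psi^{(i,s,t)}\right]+(q-q^{-1})(q^2+q^{-2})\left[\Phi^{(r,s)}\Psi^{(i,j,t)}-\Phi^{(i,t)}\Psi^{(j,r,s)}\right],\end{aligned}$$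 $$\begin{aligned}&q^{-1}\Psi^{(i,r,t)}\Phi^{(j,s)}-q\Phi^{(j,s)}\Psi^{(i,r,t)}+q\Psi^{(j,r,t)}\Phi^{(i,s)}-q^{-1}\Phi^{(i,s)}\Psi^{(j,r,t)}\\&=(q-q^{-1})\left[\Phi^{(r,s)}\Psi^{(i,j,t)}-\Phi^{(s,t)}\Psi^{(i,j,r)}\right]+(q-q^{-1})(q^2+q^{-2})\left[\Phi^{(i,t)}\Psi^{(j,r,s)}-\Phi^{(j,r)}\Psi^{(i,s,t)}\right],\end{aligned}$$ $$\begin{aligned}&q^{-1}\Psi^{(j,r,t)}\Phi^{(i,s)}-q\Phi^{(i,s)}\Psi^{(j,r,t)}+q\Psi^{(j,s,t)}\Phi^{(i,r)}-q^{-1}\Phi^{(i,r)}\Psi^{(j,s,t)}\\&=(q-q^{-1})\left[\Phi^{(i,t)}\Psi^{(j,r,s)}-\Phi^{(i,j)}\Psi^{(r,s,t)}\right]+(q-q^{-1})(q^2+q^{-2})\left[\Phi^{(j,r)}\Psi^{(i,s,t)}-\Phi^{(s,t)}\Psi^{(i,j,r)}\right].\end{aligned}$$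
   Context: $\mathrm{U}_q=\mathrm{U}_q(G_2)$ is the quantum group over $\mathbb{C}(q)$ ($q$ an indeterminate) with generators $E_i,F_i,K_i^{\pm1}$, $i=1,2$, and the standard Drinfeld–Jimbo relations, for simple roots $\alpha_1$ (short), $\alpha_2$ with $(\alpha_1,\alpha_1)=2$, $(\alpha_1,\alpha_2)=-3$, $(\alpha_2,\alpha_2)=6$. Co-multiplication: $\Delta(E_i)=E_i\otimes K_i+1\otimes E_i$, $\Delta(F_i)=F_i\otimes 1+K_i^{-1}\otimes F_i$, $\Delta(K_i)=K_i\otimes K_i$. $V_\lambda$ is the type-$\mathbf 1$ simple module with highest weight $\lambda$; $\lambda_1=2\alpha_1+\alpha_2$, $\lambda_2=3\alpha_1+2\alpha_2$. $V=V_{\lambda_1}$ is the 7-dimensional simple module with basis $v_1,v_2,v_3,v_0,v_{-3},v_{-2},v_{-1}$ and action (basis vectors not listed are sent to $0$): $E_1: v_2\mapsto v_1,\ v_0\mapsto (q+q^{-1})v_3,\ v_{-3}\mapsto -(q+q^{-1})v_0,\ v_{-1}\mapsto -v_{-2}$; $E_2: v_3\mapsto v_2,\ v_{-2}\mapsto -v_{-3}$; $F_1: v_1\mapsto v_2,\ v_3\mapsto v_0,\ v_0\mapsto -v_{-3},\ v_{-2}\mapsto -v_{-1}$; $F_2: v_2\mapsto v_3,\ v_{-3}\mapsto -v_{-2}$; $K_1$, $K_2$ act diagonally (in the order $v_1,v_2,v_3,v_0,v_{-3},v_{-2},v_{-1}$) with eigenvalues $(q,q^{-1},q^2,1,q^{-2},q,q^{-1})$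 and $(1,q^3,q^{-3},1,q^3,q^{-3},1)$. $V\otimes V=V_{2\lambda_1}\oplus V_{\lambda_2}\oplus V_{\lambda_1}\oplus V_0$; $\wedge_q^2V=V_{\lambda_2}\oplus V_{\lambda_1}$; $S_q(V)=T(V)/\langle\wedge_q^2V\rangle$; $X_a$ is the image of $v_a$. Braiding: with universal $R$-matrix $\sum_t\alpha_t\otimes\beta_t$, set $\check R_{W,W'}(w\otimes w')=\sum_t\beta_tw'\otimes\alpha_tw$, normalised so that $\check R_{V,V}=q^2P[2\lambda_1]+q^{-12}P[0]-P[\lambda_2]-q^{-6}P[\lambda_1]$, with $P[\mu]$ the projection of $V\otimes V$ onto $V_\mu$. The braided tensor product of module algebras $A,B$ is $A\otimes B$ with multiplication $(\mu_A\otimes\mu_B)(\mathrm{id}_A\otimes\check R_{B,A}\otimes\mathrm{id}_B)$; $\mathcal{A}_m$ is $S_q(V)^{\otimes m}$ with the iterated braided multiplication. Put $X_{ia}=1^{\otimes(i-1)}\otimes X_a\otimes1^{\otimes(m-i)}$; thus $X_{ja}X_{ib}=\sum_t\beta_t(X_{ib})\alpha_t(X_{ja})$ for $i<j$. Let $\varphi_{1,-1}=q^4$, $\varphi_{-1,1}=q^{-6}$, $\varphi_{2,-2}=q^3$, $\varphi_{-2,2}=q^{-5}$, $\varphi_{3,-3}=1$, $\varphi_{-3,3}=q^{-2}$, $\varphi_{00}=1$, other $\varphi_{ab}=0$. Let $\gamma:V\to V\otimes V$ be the unique $\mathrm{U}_q$-map with $\gamma(v_1)=v_1\otimes v_0-q^{-6}v_0\otimes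 v_1-(q^{-3}+q^{-1})(v_2\otimes v_3-q^{-3}v_3\otimes v_2)$, and write $\gamma(v_a)=\sum_{r,s}\gamma_{ars}v_r\otimes v_s$. Define $$\Phi^{(i,j)}=\sum_{a,b}\varphi_{ab}X_{ia}X_{jb},\qquad\Psi^{(i,j,k)}=\sum_{r,s,t}c_{rst}X_{ir}X_{js}X_{kt},\quad c_{rst}=-q^3\sum_c\varphi_{rc}\gamma_{cst}.$$ *)

(* Defs.v *)
From HB Require Import structures.
From mathcomp Require Import all_boot all_order all_algebra.
From mathcomp Require Import generic_quotient ring_quotient fraction.
From mathcomp Require Import boolp reals.
From mathcomp Require Import complex mxtens.
From mathcomp Require Import finmap monalg.

Set Implicit Arguments.
Unset Strict Implicit.
Unset Printing Implicit Defensive.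
Import GRing.Theory.
Local Open Scope ring_scope.
Local Open Scope quotient_scope.

Section LinearExtension.
Variable K : fieldType.

(* The linear map from the free vector space on G given by its values f on the
   basis << g >>. *)
Definition lin (G : choiceType) (M : lmodType K) (f : G -> M)
    (x : {malg K[G]}) : M := \sum_(g <- msupp x) mcoeff g x *: f g.

Definition lin2 (G H : choiceType) (M : lmodType K) (f : G -> H -> M)
    (x : {malg K[G]}) (y : {malg K[H]}) : M :=
  lin (fun g => lin (f g) y) x.

(* {malg K[G * H]} is the tensor product of {malg K[G]} and {malg K[H]}. *)
Definition tens (G H : choiceType) (x : {malg K[G]}) (y : {malg K[H]}) :
    {malg K[(G * H)%type]} := lin2 (fun g h => << (g, h) >>) x y.

Definition lspan (M : lmodType K) (G : M -> Prop) (x : M) : Prop :=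
  forall P : M -> Prop, P 0 -> (forall a u v, P u -> P v -> P (a *: u + v)) ->
    (forall g, G g -> P g) -> P x.

Lemma lspan0 (M : lmodType K) (G : M -> Prop) : lspan G 0.
Proof. by move=> P P0. Qed.

Lemma lspanP (M : lmodType K) (G : M -> Prop) a u v :
  lspan G u -> lspan G v -> lspan G (a *: u + v).
Proof. by move=> Gu Gv P P0 PD PG; exact: PD (Gu P P0 PD PG) (Gv P P0 PD PG). Qed.

End LinearExtension.

Definition letter := 'I_7.
Definition v1  : letter := @Ordinal 7 0 isT.
Definition v2  : letter := @Ordinal 7 1 isT.
Definition v3  : letter := @Ordinal 7 2 isT.
Definition v0  : letter := @Ordinal 7 3 isT.
Definition vm3 : letter := @Ordinal 7 4 isT.
Definition vm2 : letter := @Ordinal 7 5 isT.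
Definition vm1 : letter := @Ordinal 7 6 isT.

(* Generators of U_q(G_2); K1V and K2V are the inverses of K1 and K2.
   Submodules of V (x) V and U_q-maps only depend on the action of these. *)
Variant Uq_gen := E1 | E2 | F1 | F2 | K1 | K2 | K1V | K2V.

Section G2.
Variables (K : fieldType) (q : K).

(* Vectors are row vectors and operators act on the right, so
   delta_mx a b is the operator v_a |-> v_b. *)
Local Notation d := (@delta_mx K 7 7).

Definition q_diag (s : seq int) : 'M[K]_7 := diag_mx (\row_j q ^ s`_j).

Definition rhoV (g : Uq_gen) : 'M[K]_7 :=
  match g with
  | E1 => d v2 v1 + (q + q^-1) *: d v0 v3 - (q + q^-1) *: d vm3 v0 - d vm1 vm2
  | E2 => d v3 v2 - d vm2 vm3
  | F1 => d v1 v2 + d v3 v0 - d v0 vm3 - d vm2 vm1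
  | F2 => d v2 v3 - d vm3 vm2
  | K1 => q_diag [:: 1; -1; 2; 0; -2; 1; -1]
  | K2 => q_diag [:: 0; 3; -3; 0; 3; -3; 0]
  | K1V => q_diag [:: -1; 1; -2; 0; 2; -1; 1]
  | K2V => q_diag [:: 0; -3; 3; 0; -3; 3; 0]
  end.

(* The action on V (x) V through the comultiplication; *t is the Kronecker
   product, and v_a (x) v_b is the basis vector of index mxtens_index (a, b). *)
Definition rhoVV (g : Uq_gen) : 'M[K]_(7 * 7) :=
  match g with
  | E1 => rhoV E1 *t rhoV K1 + 1%:M *t rhoV E1
  | E2 => rhoV E2 *t rhoV K2 + 1%:M *t rhoV E2
  | F1 => rhoV F1 *t 1%:M + rhoV K1V *t rhoV F1
  | F2 => rhoV F2 *t 1%:M + rhoV K2V *t rhoV F2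
  | _ => rhoV g *t rhoV g
  end.

Definition vv (a b : letter) : 'rV[K]_(7 * 7) :=
  delta_mx 0 (mxtens_index (a, b)).

Definition VV_submodule (W : 'M[K]_(7 * 7)) : Prop :=
  forall g, (W *m rhoVV g <= W)%MS.

(* u is a highest weight vector of weight mu = a alpha_1 + b alpha_2: it is
   killed by the E_i and K_i acts by q^(alpha_i, mu). *)
Definition VV_hw_vector (a b : int) (u : 'rV[K]_(7 * 7)) : Prop :=
  [/\ u != 0, u *m rhoVV E1 = 0, u *m rhoVV E2 = 0,
      u *m rhoVV K1 = q ^ (2 * a - 3 * b) *: u
    & u *m rhoVV K2 = q ^ (6 * b - 3 * a) *: u].

Definition VV_simple_hw (a b : int) (W : 'M[K]_(7 * 7)) : Prop :=
  [/\ VV_submodule W,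
      forall U : 'M[K]_(7 * 7), VV_submodule U -> (U <= W)%MS ->
        U = 0 \/ (W <= U)%MS
    & exists2 u, (u <= W)%MS & VV_hw_vector a b u].

(* The decomposition V (x) V = V_{2 lambda_1} + V_{lambda_2} + V_{lambda_1}
   + V_0, where lambda_1 = 2 alpha_1 + alpha_2 and
   lambda_2 = 3 alpha_1 + 2 alpha_2. *)
Record VV_decomposition := {
  V2l1 : 'M[K]_(7 * 7);
  Vl2 : 'M[K]_(7 * 7);
  Vl1 : 'M[K]_(7 * 7);
  Vzero : 'M[K]_(7 * 7);
  V2l1_simple : VV_simple_hw 4 2 V2l1;
  Vl2_simple : VV_simple_hw 3 2 Vl2;
  Vl1_simple : VV_simple_hw 2 1 Vl1;
  Vzero_simple : VV_simple_hw 0 0 Vzero;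
  VV_direct : mxdirect (V2l1 + Vl2 + Vl1 + Vzero);
  VV_full : (V2l1 + Vl2 + Vl1 + Vzero :=: 1%:M)%MS
}.

Variable D : VV_decomposition.

Definition Rcheck : 'M[K]_(7 * 7) :=
  q ^+ 2 *: proj_mx (V2l1 D) (Vl2 D + Vl1 D + Vzero D)%MS
  + q ^- 12 *: proj_mx (Vzero D) (V2l1 D + Vl2 D + Vl1 D)%MS
  - proj_mx (Vl2 D) (V2l1 D + Vl1 D + Vzero D)%MS
  - q ^- 6 *: proj_mx (Vl1 D) (V2l1 D + Vl2 D + Vzero D)%MS.

(* T(V) is the free algebra on the letters. *)
Definition word : choiceType := {fmonom letter}.
Definition TV : lalgType K := {malg K[word]}.

Definition wedge2 : 'M[K]_(7 * 7) := (Vl2 D + Vl1 D)%MS.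

Definition TV_of_VV (u : 'rV[K]_(7 * 7)) : TV :=
  \sum_a \sum_b u 0 (mxtens_index (a, b)) *: << FMonom [:: a; b] >>.

(* The two-sided ideal of T(V) generated by wedge2, so that
   S_q(V) = T(V) / Sq_ideal. *)
Definition Sq_ideal : TV -> Prop :=
  lspan (fun z => exists x u y,
    (u <= wedge2)%MS /\ z = x * TV_of_VV u * y).

(* Basis of T(V)^{(x) m}. *)
Fixpoint mword (m : nat) : choiceType :=
  if m is n.+1 then (word * mword n)%type else unit.

Fixpoint mword_one (m : nat) : mword m :=
  if m is n.+1 then (mone, mword_one n) else tt.

Definition TVm (m : nat) : lmodType K := {malg K[mword m]}.

(* The braiding on tensor powers is determined by Rcheck: the identities
   (Delta (x) id) R = R_13 R_23 and (id (x) Delta) R = R_13 R_12 of the universal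
   R-matrix say that a tensor product crosses another factor by crossing it
   successively. By naturality the braiding of S_q(V) is induced from these. *)

Definition braid_letters (a b : letter) :
    {malg K[(letter * letter)%type]} :=
  \sum_c \sum_e Rcheck (mxtens_index (a, b)) (mxtens_index (c, e)) *:
    << (c, e) >>.

(* Rcheck_{V, T(V)} : V (x) T(V) -> T(V) (x) V *)
Fixpoint braid_letter_seq (a : letter) (w : seq letter) :
    {malg K[(seq letter * letter)%type]} :=
  if w is b :: w' then
    lin (fun ba => lin (fun wa => << (ba.1 :: wa.1, wa.2) >>)
                       (braid_letter_seq ba.2 w'))
        (braid_letters a b)
  else << ([::], a) >>.

(* Rcheck_{T(V), T(V)} *)
Fixpoint braid_seq (u w : seq letter) :
    {malg K[(seq letter * seq letter)%type]} :=
  if u is a :: u' then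
    lin (fun wu => lin (fun wa => << (wa.1, wa.2 :: wu.2) >>)
                       (braid_letter_seq a wu.1))
        (braid_seq u' w)
  else << (w, [::]) >>.

Definition braid_word (u w : word) : {malg K[(word * word)%type]} :=
  lin (fun wu => << (FMonom wu.1, FMonom wu.2) >>) (braid_seq u w).

(* Rcheck_{T(V)^{(x) m}, T(V)} *)
Fixpoint braid_mword (m : nat) :
    mword m -> word -> {malg K[(word * mword m)%type]} :=
  match m return mword m -> word -> {malg K[(word * mword m)%type]} with
  | 0 => fun us w => << (w, us) >>
  | n.+1 => fun us w =>
      lin (fun wu => lin (fun wv => << (wv.1, (wv.2, wu.2)) >>)
                         (braid_word us.1 wu.1))
          (braid_mword us.2 w)
  end.

(* The braided product of T(V)^{(x) m}, as A (x) B with A = T(V) and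
   B = T(V)^{(x) (m - 1)}: (mu_A (x) mu_B) (id (x) Rcheck_{B,A} (x) id). *)
Fixpoint mword_mul (m : nat) : mword m -> mword m -> {malg K[mword m]} :=
  match m return mword m -> mword m -> {malg K[mword m]} with
  | 0 => fun _ _ => << tt >>
  | n.+1 => fun us ws =>
      lin (fun wv => tens << mmul us.1 wv.1 >> (mword_mul wv.2 ws.2))
          (braid_mword us.2 ws.1)
  end.

Definition TVm_mul (m : nat) : TVm m -> TVm m -> TVm m :=
  lin2 (@mword_mul m).

(* The kernel of T(V)^{(x) m} -> S_q(V)^{(x) m}: the kernel of
   A (x) B -> A / I (x) B / J is I (x) B + A (x) J. *)
Fixpoint Am_ker (m : nat) : TVm m -> Prop :=
  match m with
  | 0 => fun z => z = 0
  | n.+1 => lspan (fun z : {malg K[(word * mword n)%type]} =>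
      exists (x : {malg K[word]}) (y : {malg K[mword n]}),
        (Sq_ideal x \/ Am_ker y) /\ z = tens x y)
  end.

Lemma Am_ker0 m : @Am_ker m 0.
Proof. by case: m => //= n; apply: lspan0. Qed.

Lemma Am_kerP m a (u v : TVm m) : Am_ker u -> Am_ker v -> Am_ker (a *: u + v).
Proof.
case: m u v => [|n] u v; last exact: lspanP.
by move=> /= -> ->; rewrite scaler0 addr0.
Qed.

Definition Am_kerb m : {pred TVm m} := fun z => `[< Am_ker z >].

Lemma Am_kerb_zmod m : zmod_closed (@Am_kerb m).
Proof.
split=> [|x y /asboolP kx /asboolP ky]; apply/asboolP; first exact: Am_ker0.
by rewrite addrC -scaleN1r; apply: Am_kerP.
Qed.

HB.instance Definition _ m :=
  GRing.isZmodClosed.Build (TVm m) (@Am_kerb m) (@Am_kerb_zmod m).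

(* A_m = S_q(V)^{(x) m} *)
Definition Am (m : nat) : Type := Quotient.quot (@Am_kerb m).

HB.instance Definition _ m := GRing.Zmodule.on (Am m).

Definition Am_of (m : nat) (x : TVm m) : Am m := \pi_(Quotient.quot _) x.

Definition Am_scale (m : nat) (a : K) (x : Am m) : Am m := Am_of (a *: repr x).

Lemma Am_of_eq m (x y : TVm m) : Am_ker (x - y) -> Am_of x = Am_of y.
Proof.
by move=> k; apply/eqP; rewrite -Quotient.idealrBE; apply/asboolP.
Qed.

Lemma Am_of_ker m (x y : TVm m) : Am_of x = Am_of y -> Am_ker (x - y).
Proof.
by move=> /eqP; rewrite -Quotient.idealrBE => /asboolP.
Qed.

Lemma Am_ofD m (x y : TVm m) : Am_of (x + y) = Am_of x + Am_of y.
Proof. exact: Quotient.pi_add. Qed.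

Lemma Am_repr m (x : Am m) : Am_of (repr x) = x.
Proof. exact: reprK. Qed.

Lemma Am_scaleE m a (x : TVm m) : Am_scale a (Am_of x) = Am_of (a *: x).
Proof.
apply: Am_of_eq; rewrite -scalerBr -[_ *: _]addr0; apply: Am_kerP.
  by apply: Am_of_ker; rewrite Am_repr.
exact: Am_ker0.
Qed.

Lemma Am_scaleA m a b (x : Am m) :
  Am_scale a (Am_scale b x) = Am_scale (a * b) x.
Proof. by rewrite -[x]Am_repr !Am_scaleE scalerA. Qed.

Lemma Am_scale1 m : left_id 1 (@Am_scale m).
Proof. by move=> x; rewrite -[x]Am_repr Am_scaleE scale1r. Qed.

Lemma Am_scaleDr m : right_distributive (@Am_scale m) +%R.
Proof.
move=> a x y; rewrite -[x]Am_repr -[y]Am_repr -Am_ofD !Am_scaleE scalerDr.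
exact: Am_ofD.
Qed.

Lemma Am_scaleDl m (x : Am m) : {morph (@Am_scale m)^~ x : a b / a + b}.
Proof.
by move=> a b; rewrite -[x]Am_repr !Am_scaleE scalerDl Am_ofD.
Qed.

HB.instance Definition _ m := GRing.Zmodule_isLmodule.Build K (Am m)
  (@Am_scaleA m) (@Am_scale1 m) (@Am_scaleDr m) (@Am_scaleDl m).

(* The braided product on chosen representatives; the result does not depend on
   them because wedge2 is a submodule and the braiding is natural. *)
Definition Am_mul (m : nat) : Am m -> Am m -> Am m :=
  lift_op2 (Quotient.quot (@Am_kerb m)) (@TVm_mul m).

Fixpoint mword_X (m i : nat) (a : letter) : mword m :=
  match m, i with
  | 0, _ => tt
  | n.+1, 0 => (FMonom [:: a], mword_one n)
  | n.+1, k.+1 => (mone, mword_X n k a)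
  end.

(* X_{ia}, the copies of S_q(V) being numbered from 0. *)
Definition X (m : nat) (i : 'I_m) (a : letter) : Am m :=
  Am_of << mword_X m i a >>.

Local Notation "x *q y" := (Am_mul x y) (at level 40, left associativity).

(* phi a b is the coefficient phi_{ab}. *)
Definition phi : 'M[K]_7 :=
  q ^+ 4 *: d v1 vm1 + q ^- 6 *: d vm1 v1
  + q ^+ 3 *: d v2 vm2 + q ^- 5 *: d vm2 v2
  + d v3 vm3 + q ^- 2 *: d vm3 v3 + d v0 v0.

Definition Phi (m : nat) (i j : 'I_m) : Am m :=
  \sum_a \sum_b phi a b *: (X i a *q X j b).

(* gamma : V -> V (x) V, with gamma(v_a) in row a, is a U_q-map with the
   prescribed value at v_1; this determines it. *)
Definition is_gamma (gamma : 'M[K]_(7, 7 * 7)) : Prop :=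
  (forall g, rhoV g *m gamma = gamma *m rhoVV g) /\
  row v1 gamma = vv v1 v0 - q ^- 6 *: vv v0 v1
    - (q ^- 3 + q^-1) *: (vv v2 v3 - q ^- 3 *: vv v3 v2).

Definition psi_coef (gamma : 'M[K]_(7, 7 * 7)) (r s t : letter) : K :=
  - q ^+ 3 * \sum_c phi r c * gamma c (mxtens_index (s, t)).

Definition Psi (gamma : 'M[K]_(7, 7 * 7)) (m : nat) (i j k : 'I_m) : Am m :=
  \sum_r \sum_s \sum_t psi_coef gamma r s t *: (X i r *q X j s *q X k t).

End G2.

Notation "x *q y" := (Am_mul x y) (at level 40, left associativity).

(* C(q), with R[i] the complex numbers *)
Definition Cq (R : realType) : fieldType := {fraction {poly R[i]}}.
Definition q (R : realType) : Cq R := FracField.tofrac 'X.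
Arguments q {R}.

(* Main.v *)
From HB Require Import structures.
From Stdlib Require Import ZArith.
Require Import Defs.
From mathcomp Require Import all_boot all_order all_algebra reals.
From mathcomp Require Import fraction boolp complex mxtens finmap monalg.
From mathcomp Require Import ssrZ zify ring.

(* No relation of S_q(V) is used: the relations already hold in the braided
   tensor power of T(V). The invariants are tensors phi in V^{(x) 2} and psi in
   V^{(x) 3}, and a product of generators X_{pa} is put in the order of its
   positions by applying Rcheck to adjacent tensor factors whenever two
   positions are in decreasing order. So every product Phi Psi or Psi Phi
   becomes an explicit tensor in V^{(x) 5}, namely a positive braid applied to
   phi (x) psi or psi (x) phi, and (2) and (3) are identities between Laurent
   polynomials, which are checked by computation; (1) is a case of (2).

   The matrix B of Rcheck is identified as follows. B commutes with U_q, and by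
   a linear certificate it acts by a scalar on highest weight vectors of each of
   the four weights, hence on the simple submodules that they generate. The
   product on representatives descends to the quotient because wedge2 is the
   image of (B - q^2) (B - q^-12), which passes through the braiding by the
   Yang-Baxter equation. *)

Set Implicit Arguments.
Unset Strict Implicit.
Unset Printing Implicit Defensive.
Import GRing.Theory.
Local Open Scope ring_scope.

(** * Sparse tensors with Laurent polynomial coefficients *)

(** [Rcheck] is built from projections attached to an arbitrary decomposition, so it cannot be
    evaluated. The table [tab_braid] is therefore an explicit candidate, proved equal to [Rcheck]
    for every decomposition.

    Associativity of the braided product is never proved. Products are expanded as iterated right
    multiplications by generators, where only one exchange rule is needed: for p < p', multiplying
    by X_{p'b} and then X_{pa} is a combination of multiplying by X_{pc} and then X_{p'e}. Weakly
    increasing positions need no crossing at all, which is why the case i = j is no different from i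
    < j.

    Computation takes place over Z[q, q^-1] and is evaluated in a field K. Of C(q) only two facts
    are used: q is nonzero and no nontrivial integer power of q is 1. The second separates weights
    by the eigenvalues of [K1] and [K2], and makes every 1 + q^n with n nonzero invertible. *)

Section Merge.
Variables (A V : Type) (cmp : A -> A -> comparison).
Variables (add : V -> V -> V) (isz : V -> bool).

(** The inner [fix] makes the recursion structural in each list in turn. Entries that cancel are
    dropped, so that a vanishing sum of sorted lists becomes the empty list. *)
Fixpoint merge_add (l1 : seq (A * V)) : seq (A * V) -> seq (A * V) :=
  if l1 is (a, x) :: l1' then
    fix aux l2 :=
      if l2 is (b, y) :: l2' then
        match cmp a b with
        | Lt => (a, x) :: merge_add l1' l2
        | Gt => (b, y) :: aux l2'
        | Eq => let z := add x y in
                if isz z then merge_add l1' l2' else (a, z) :: merge_add l1' l2'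
        end
      else l1
  else id.

(* A binary counter of merged lists. *)
Fixpoint merge_push (l : seq (A * V)) (st : seq (seq (A * V))) :=
  match st with
  | [::] => [:: l]
  | [::] :: st' => l :: st'
  | m :: st' => [::] :: merge_push (merge_add m l) st'
  end.

Definition merge_all (ls : seq (seq (A * V))) : seq (A * V) :=
  foldr merge_add [::] (foldl (fun st l => merge_push l st) [::] ls).

Hypothesis cmpP : forall a b, cmp a b = Eq -> a = b.
Variables (M : nmodType) (F : A -> V -> M).
Hypothesis FD : forall a x y, F a (add x y) = F a x + F a y.
Hypothesis Fz : forall a x, isz x -> F a x = 0.

(** Sortedness is not assumed: entries are combined only when their keys are equal, so the sum is
    preserved for any two lists. The order only makes cancellation complete, hence it never has to
    be proved. *)
Lemma merge_addE l1 l2 : \sum_(x <- merge_add l1 l2) F x.1 x.2 =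
  \sum_(x <- l1) F x.1 x.2 + \sum_(x <- l2) F x.1 x.2.
Proof.
elim: l1 l2 => [|[a x] l1 IH1] l2 /=; first by rewrite big_nil add0r.
elim: l2 => [|[b y] l2 IH2]; first by rewrite big_nil addr0.
case E: (cmp a b).
- rewrite -(cmpP E) !big_cons /= addrACA -FD.
  by case: ifP => [z|_]; rewrite ?big_cons /= IH1 ?(Fz _ z) ?add0r.
- by rewrite big_cons /= IH1 [in RHS]big_cons addrA.
- by rewrite big_cons /= IH2 [X in _ = _ + X]big_cons /= addrCA.
Qed.

Lemma merge_pushE l st : \sum_(m <- merge_push l st) \sum_(x <- m) F x.1 x.2 =
  \sum_(x <- l) F x.1 x.2 + \sum_(m <- st) \sum_(x <- m) F x.1 x.2.
Proof.
elim: st l => [|[|x m] st IH] l.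
- by rewrite big_seq1 big_nil addr0.
- by rewrite !big_cons big_nil add0r.
- by rewrite -[merge_push l _]/([::] :: merge_push (merge_add (x :: m) l) st) [LHS]big_cons big_nil add0r IH merge_addE
    [X in _ = _ + X]big_cons addrCA addrA.
Qed.

Lemma merge_allE ls : \sum_(x <- merge_all ls) F x.1 x.2 =
  \sum_(m <- ls) \sum_(x <- m) F x.1 x.2.
Proof.
rewrite /merge_all; transitivity (\sum_(m <- foldl (fun st l => merge_push l st) [::] ls)
   \sum_(x <- m) F x.1 x.2).
  elim: (foldl _ _ _) => [|m st IH] /=; first by rewrite !big_nil.
  by rewrite merge_addE IH big_cons.
rewrite -[RHS]addr0 -[X in _ = _ + X](big_nil _ +%R predT (fun m => \sum_(x <- m) F x.1 x.2)).
elim: ls [::] => [|l ls IH] st /=; first by rewrite big_nil add0r.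
by rewrite IH merge_pushE big_cons addrA [X in X + _ = _]addrC.
Qed.
End Merge.

(* Pairs (exponent, coefficient), by increasing exponent. *)
Definition laurent := seq (Z * Z).
Definition ladd : laurent -> laurent -> laurent := merge_add Z.compare Z.add (Z.eqb 0).
Definition lmul (p r : laurent) : laurent :=
  merge_all Z.compare Z.add (Z.eqb 0)
    [seq [seq (Z.add x.1 y.1, Z.mul x.2 y.2) | y <- r] | x <- p].

Fixpoint word_compare (u w : seq letter) : comparison :=
  match u, w with
  | [::], [::] => Eq
  | [::], _ => Lt
  | _, [::] => Gt
  | a :: u', b :: w' =>
      match Nat.compare a b with Eq => word_compare u' w' | c => c end
  end.

Lemma word_compareP u w : word_compare u w = Eq -> u = w.
Proof.
elim: u w => [|a u IH] [|b w] //=.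
case E: (Nat.compare a b) => // /IH ->; congr (_ :: _); apply: val_inj.
exact: (Nat.compare_eq a b E).
Qed.

(* A sum of basis words with Laurent polynomial coefficients, the words
   increasing in lexicographic order. *)
Definition tensor := seq (seq letter * laurent).
Definition tadd : tensor -> tensor -> tensor := merge_add word_compare ladd (fun p => nilp p).
Definition tscale (p : laurent) (T : tensor) : tensor := [seq (x.1, lmul p x.2) | x <- T].
Definition tbind (g : seq letter -> tensor) (T : tensor) : tensor :=
  merge_all word_compare ladd (fun p => nilp p) [seq tscale x.2 (g x.1) | x <- T].
(** Compares by cancelling T - S. Only soundness ([teval_teq]) is needed, so the normal form need
    not be canonical. *)
Definition teq (T S : tensor) : bool := nilp (tadd T (tscale [:: (Z0, Zneg xH)] S)).

Section Eval.
Variables (K : fieldType) (q : K).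
Hypothesis q0 : q != 0.

Definition leval (p : laurent) : K :=
  \sum_(x <- p) (int_of_Z x.2)%:~R * q ^ (int_of_Z x.1).

Lemma leval_add p r : leval (ladd p r) = leval p + leval r.
Proof.
apply: (@merge_addE _ _ _ _ _ _ _ (fun e c => (int_of_Z c)%:~R * q ^ (int_of_Z e))).
- by move=> a b /Z.compare_eq.
- by move=> a x y /=; rewrite -mulrDl -intrD -[Z.add _ _]/(x + y) rmorphD.
- by move=> a x /Z.eqb_eq <-; rewrite mul0r.
Qed.

Lemma leval_mul p r : leval (lmul p r) = leval p * leval r.
Proof.
rewrite /leval /lmul.
rewrite (@merge_allE _ _ _ _ _ _ _ (fun e c => (int_of_Z c)%:~R * q ^ (int_of_Z e))).
- rewrite big_map mulr_suml; apply: eq_bigr => x _.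
  rewrite big_map mulr_sumr; apply: eq_bigr => y _ /=.
  rewrite -[Z.add _ _]/(x.1 + y.1) -[Z.mul _ _]/(x.2 * y.2).
  by rewrite !rmorphM rmorphD /= expfzDr // mulrACA.
- by move=> a b /Z.compare_eq.
- by move=> a x y /=; rewrite -mulrDl -intrD -[Z.add _ _]/(x + y) rmorphD.
- by move=> a x /Z.eqb_eq <-; rewrite mul0r.
Qed.

Lemma leval_nil : leval [::] = 0. Proof. exact: big_nil. Qed.

Variable M : lmodType K.
Implicit Types (f : seq letter -> M) (T : tensor).

Definition teval f T : M := \sum_(x <- T) leval x.2 *: f x.1.

Lemma teval_nil f : teval f [::] = 0. Proof. exact: big_nil. Qed.

Lemma teval_cons f w p T : teval f ((w, p) :: T) = leval p *: f w + teval f T.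
Proof. exact: big_cons. Qed.

Lemma teval_scale f p T : teval f (tscale p T) = leval p *: teval f T.
Proof.
rewrite /teval big_map scaler_sumr; apply: eq_bigr => x _ /=.
by rewrite leval_mul scalerA.
Qed.

Lemma teval_merge_ok f :
  (forall a b, word_compare a b = Eq -> a = b) /\
  (forall a x y, leval (ladd x y) *: f a = leval x *: f a + leval y *: f a) /\
  (forall a (x : laurent), nilp x -> leval x *: f a = 0).
Proof.
split; first exact: word_compareP.
split=> [a x y|a x /nilP ->]; first by rewrite leval_add scalerDl.
by rewrite leval_nil scale0r.
Qed.

Lemma teval_add f T S : teval f (tadd T S) = teval f T + teval f S.
Proof.
have [H1 [H2 H3]] := teval_merge_ok f.
exact: (@merge_addE _ _ _ _ _ _ _ (fun w p => leval p *: f w)).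
Qed.

Lemma teval_bind f g T : teval f (tbind g T) = teval (fun w => teval f (g w)) T.
Proof.
have [H1 [H2 H3]] := teval_merge_ok f.
rewrite /teval (@merge_allE _ _ _ _ _ _ _ (fun w p => leval p *: f w)) // big_map.
by apply: eq_bigr => x _; exact: teval_scale.
Qed.

Lemma teval_teq f T S : teq T S -> teval f T = teval f S.
Proof.
move=> /nilP E; apply/eqP; rewrite -subr_eq0 -(teval_nil f) -E teval_add teval_scale.
by rewrite /leval big_seq1 /= expr0z mulr1 scaleN1r.
Qed.

Lemma eq_teval f g T : (forall w, f w = g w) -> teval f T = teval g T.
Proof. by move=> E; apply: eq_bigr => x _; rewrite E. Qed.

End Eval.

(** Linearity is a hypothesis and not a structure on [h], for use with maps such as
    [fun x => x *q y]. *)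
Lemma teval_linear (K : fieldType) (q : K) (M N : lmodType K) (h : M -> N) f T :
  linear h -> h (teval q f T) = teval q (fun w => h (f w)) T.
Proof.
move=> hl; have h0 : h 0 = 0.
  by rewrite -[0 in LHS](subrr 0) -scaleN1r addrC hl scaleN1r addNr.
elim: T => [|[w p] T IH]; first by rewrite !teval_nil.
by rewrite !teval_cons hl IH.
Qed.

(** * Linear extensions *)

Section Lin.
Variable K : fieldType.

(** Allows several elements with different supports to be summed over one common finite set. *)
Lemma linEw (G : choiceType) (M : lmodType K) (f : G -> M) (d : {fset G})
    (x : {malg K[G]}) : (msupp x `<=` d)%fset ->
  lin f x = \sum_(g <- d) mcoeff g x *: f g.
Proof.
move=> le; rewrite [LHS](big_fset_incl _ le) => //= g gd /mcoeff_outdom ->.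
by rewrite scale0r.
Qed.

Lemma lin_is_linear (G : choiceType) (M : lmodType K) (f : G -> M) :
  linear (lin f).
Proof.
move=> a x y; set d := (msupp x `|` msupp y)%fset.
rewrite !(@linEw _ _ f d) ?fsubsetUl ?fsubsetUr //.
  rewrite scaler_sumr -big_split; apply: eq_bigr => g _ /=.
  by rewrite mcoeffD mcoeffZ scalerDl scalerA.
apply: fsubset_trans (msuppD_le _ _) _.
by apply: fsetUSS => //; apply: msuppZ_le.
Qed.

HB.instance Definition _ (G : choiceType) (M : lmodType K) (f : G -> M) :=
  GRing.isLinear.Build K {malg K[G]} M *:%R (lin f) (lin_is_linear f).

Lemma linU (G : choiceType) (M : lmodType K) (f : G -> M) g :
  lin f << g >> = f g.
Proof. by rewrite (linEw _ msuppU_le) big_seq_fset1 mcoeffUU scale1r. Qed.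

Lemma eq_lin (G : choiceType) (M : lmodType K) (f h : G -> M) x :
  (forall g, f g = h g) -> lin f x = lin h x.
Proof. by move=> E; apply: eq_bigr => g _; rewrite E. Qed.

Lemma lin_linear (G : choiceType) (M N : lmodType K) (h : {linear M -> N})
  (f : G -> M) x : h (lin f x) = lin (fun g => h (f g)) x.
Proof.
rewrite /lin; elim: (enum_fset (msupp x)) => [|g s IH].
  by rewrite !big_nil raddf0.
by rewrite !big_cons linearP IH.
Qed.

Lemma lin_lin (G H : choiceType) (M : lmodType K) (f : H -> M)
  (h : G -> {malg K[H]}) x : lin f (lin h x) = lin (fun g => lin f (h g)) x.
Proof. exact: lin_linear. Qed.

Lemma lin_exch (G H : choiceType) (M : lmodType K) (F : G -> H -> M) x y :
  lin (fun a => lin (F a) y) x = lin (fun b => lin (F^~ b) x) y.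
Proof.
rewrite /lin [RHS](eq_bigr (fun b => \sum_(a <- msupp x) (mcoeff b y * mcoeff a x) *: F a b)).
  rewrite exchange_big; apply: eq_bigr => a _; rewrite scaler_sumr.
  by apply: eq_bigr => b _; rewrite scalerA mulrC.
by move=> b _; rewrite scaler_sumr; apply: eq_bigr => a _; rewrite scalerA.
Qed.

Lemma lin0 (G : choiceType) (M : lmodType K) (x : {malg K[G]}) :
  lin (fun=> 0 : M) x = 0.
Proof. by apply: big1 => g _; rewrite scaler0. Qed.

Lemma malg_sum (G : choiceType) (x : {malg K[G]}) : lin (fun g => << g >>) x = x.
Proof.
rewrite [RHS]monalgE; apply: eq_bigr => g _; apply/malgP => k.
by rewrite mcoeffZ !mcoeffU mulrnAr mulr1.
Qed.

Lemma lin_closed (G : choiceType) (M : lmodType K) (P : M -> Prop) (f : G -> M) x :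
  P 0 -> (forall a u v, P u -> P v -> P (a *: u + v)) ->
  (forall g, P (f g)) -> P (lin f x).
Proof.
move=> P0 PD Pf; rewrite /lin; elim: (msupp x : seq _) => [|g s IH].
  by rewrite big_nil.
by rewrite big_cons; apply: PD.
Qed.

Lemma lin_teval (q : K) (G : choiceType) (M : lmodType K) (f : G -> M)
  (h : seq letter -> {malg K[G]}) T : lin f (teval q h T) = teval q (fun w => lin f (h w)) T.
Proof. exact: teval_linear (lin_is_linear f). Qed.

Lemma tensE (G H : choiceType) (x : {malg K[G]}) (y : {malg K[H]})
  (M : lmodType K) (f : (G * H)%type -> M) :
  lin f (tens x y) = lin (fun g => lin (fun h => f (g, h)) y) x.
Proof.
rewrite /tens /lin2 lin_lin; apply: eq_lin => g; rewrite lin_lin.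
by apply: eq_lin => h; rewrite linU.
Qed.

End Lin.

Notation "'bind' a <- x ; y" := (lin (fun a => y) x)
  (at level 200, a name, x at level 100, y at level 200,
   format "'[v' 'bind'  a  <-  x ; '/' y ']'").

Section Bindp.
Variable K : fieldType.

(** Identities in tensor products are stated after an arbitrary linear continuation [F] with values
    in any module. Successive crossings then become nested binds, crossings of disjoint strands
    commute by [bindp_exch], and the same identities serve inside membership proofs. *)
Definition bindp (G H : choiceType) (M : lmodType K)
    (x : {malg K[(G * H)%type]}) (F : G -> H -> M) : M :=
  lin (fun y => F y.1 y.2) x.

Lemma bindpU (G H : choiceType) (M : lmodType K) a b (F : G -> H -> M) :
  bindp << (a, b) >> F = F a b.
Proof. exact: linU. Qed.

Lemma eq_bindp (G H : choiceType) (M : lmodType K) x (F F' : G -> H -> M) :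
  (forall a b, F a b = F' a b) -> bindp x F = bindp x F'.
Proof. by move=> E; apply: eq_lin => -[a b] /=. Qed.

Lemma bindp_lin (G G' H' : choiceType) (M : lmodType K) (x : {malg K[G]})
    (f : G -> {malg K[(G' * H')%type]}) (F : G' -> H' -> M) :
  bindp (lin f x) F = lin (fun g => bindp (f g) F) x.
Proof. exact: lin_lin. Qed.

Lemma bindp_bindp (G H G' H' : choiceType) (M : lmodType K) x
    (f : G -> H -> {malg K[(G' * H')%type]}) (F : G' -> H' -> M) :
  bindp (bindp x f) F = bindp x (fun a b => bindp (f a b) F).
Proof. exact: lin_lin. Qed.

Lemma lin_bindp (G H G' : choiceType) (M : lmodType K) x
    (f : G -> H -> {malg K[G']}) (F : G' -> M) :
  lin F (bindp x f) = bindp x (fun a b => lin F (f a b)).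
Proof. exact: lin_lin. Qed.

Lemma bindp_exch (G H G' H' : choiceType) (M : lmodType K)
    (x : {malg K[(G * H)%type]}) (y : {malg K[(G' * H')%type]})
    (F : G -> H -> G' -> H' -> M) :
  bindp x (fun a b => bindp y (F a b)) =
  bindp y (fun c e => bindp x (fun a b => F a b c e)).
Proof. exact: lin_exch. Qed.

Lemma lin_bindp_exch (G G' H' : choiceType) (M : lmodType K)
    (x : {malg K[G]}) (y : {malg K[(G' * H')%type]})
    (F : G -> G' -> H' -> M) :
  lin (fun a => bindp y (F a)) x = bindp y (fun c e => lin (fun a => F a c e) x).
Proof. exact: lin_exch. Qed.

Lemma bindp0 (G H : choiceType) (M : lmodType K) (x : {malg K[(G * H)%type]}) :
  bindp x (fun _ _ => 0 : M) = 0.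
Proof. exact: lin0. Qed.
End Bindp.

Notation "'bind' ( a , b ) <- x ; y" := (bindp x (fun a b => y))
  (at level 200, a name, b name, x at level 100, y at level 200,
   format "'[v' 'bind'  ( a ,  b )  <-  x ; '/' y ']'").

Lemma mmul_word (u w : word) : mmul u w = FMonom (u ++ w).
Proof. exact: fmmulE. Qed.

Lemma mone_word : (mone : word) = FMonom [::].
Proof. exact: fmoneE. Qed.

(** * The braiding of words *)

Definition mcons n (u : word) (us : mword n) : mword n.+1 := (u, us).

(** Exposes the list of letters of the first word, on which the braiding recurses. *)
Lemma mconsP n (us : mword n.+1) : exists u us', us = mcons (FMonom u) us'.
Proof. by case: us => [[u] us]; exists u, us. Qed.

Section Braid.
Variables (K : fieldType) (q : K) (D : VV_decomposition q).
Local Notation BL := (braid_letters D).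
Local Notation bls := (braid_letter_seq D).
Local Notation bs := (braid_seq D).

Section CPS.
Variable M : lmodType K.

Lemma braid_letter_seq_nil a (F : seq letter -> letter -> M) : bindp (bls a [::]) F = F [::] a.
Proof. exact: bindpU. Qed.

Lemma braid_letter_seq_cons a b w (F : seq letter -> letter -> M) :
  bindp (bls a (b :: w)) F =
  bind (b', a') <- BL a b; bind (w', a2) <- bls a' w; F (b' :: w') a2.
Proof.
rewrite /= bindp_lin; apply: eq_lin => x; rewrite bindp_lin.
by apply: eq_lin => y; rewrite bindpU.
Qed.

Lemma braid_seq_nil w (F : seq letter -> seq letter -> M) : bindp (bs [::] w) F = F w [::].
Proof. exact: bindpU. Qed.

Lemma braid_seq_cons a u w (F : seq letter -> seq letter -> M) :
  bindp (bs (a :: u) w) F =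
  bind (w', u') <- bs u w; bind (w2, a') <- bls a w'; F w2 (a' :: u').
Proof.
rewrite /= bindp_lin; apply: eq_lin => x; rewrite bindp_lin.
by apply: eq_lin => y; rewrite bindpU.
Qed.

Lemma bind_braid_word (u w : word) (F : word -> word -> M) :
  bindp (braid_word D u w) F =
  bind (w', u') <- bs u w; F (FMonom w') (FMonom u').
Proof. by rewrite /braid_word bindp_lin; apply: eq_lin => x; rewrite bindpU. Qed.

Lemma braid_mword0 (us : mword 0) w (F : word -> mword 0 -> M) :
  bindp (braid_mword D us w) F = F w us.
Proof. exact: bindpU. Qed.

Lemma braid_mwordS n u us w (F : word -> mword n.+1 -> M) :
  bindp (braid_mword D (mcons u us) w) F =
  bind (w', us') <- braid_mword D us w;
  bind (w2, u') <- bs u w'; F (FMonom w2) (mcons (FMonom u') us').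
Proof.
rewrite /= bindp_lin; apply: eq_lin => x; rewrite bindp_lin.
rewrite -(bind_braid_word u x.1 (fun w2 u' => F w2 (mcons u' x.2))).
by apply: eq_lin => y; rewrite bindpU.
Qed.

Lemma bind_mword_mulS n u us w ws (F : mword n.+1 -> M) :
  lin F (mword_mul D (mcons u us) (mcons w ws)) =
  bind (w', us') <- braid_mword D us w;
  bind vs <- mword_mul D us' ws; F (mcons (mmul u w') vs).
Proof.
rewrite /= lin_lin; apply: eq_lin => x; rewrite tensE linU.
by [].
Qed.
End CPS.

Opaque bindp lin braid_letters.

(* braid_seq with a one letter word on the right, from which the letter is
   read off without inspecting the length of the result. *)
Fixpoint braid_seq_letter (u : seq letter) (a : letter) :
    {malg K[(letter * seq letter)%type]} :=
  if u is b :: u' then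
    bind (a', u2) <- braid_seq_letter u' a;
    bind (a2, b') <- BL b a'; << (a2, b' :: u2) >>
  else << (a, [::]) >>.
Local Notation bsl := braid_seq_letter.

Fixpoint braid_mword_letter (m : nat) :
    mword m -> letter -> {malg K[(letter * mword m)%type]} :=
  match m return mword m -> letter -> {malg K[(letter * mword m)%type]} with
  | 0 => fun us a => << (a, us) >>
  | n.+1 => fun us a =>
     bind (a', us') <- braid_mword_letter us.2 a;
     bind (a2, u') <- bsl us.1 a'; << (a2, mcons (FMonom u') us') >>
  end.
Local Notation bml := braid_mword_letter.

Section CPS2.
Variable M : lmodType K.

Lemma braid_seq_letter_cons b u a (F : letter -> seq letter -> M) :
  bindp (bsl (b :: u) a) F =
  bind (a', u') <- bsl u a; bind (a2, b') <- BL b a'; F a2 (b' :: u').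
Proof.
rewrite /= bindp_bindp; apply: eq_bindp => x y; rewrite bindp_bindp.
by apply: eq_bindp => z t; rewrite bindpU.
Qed.

Lemma braid_mword_letterS n u us a (F : letter -> mword n.+1 -> M) :
  bindp (bml (mcons u us) a) F =
  bind (a', us') <- bml us a; bind (a2, u') <- bsl u a'; F a2 (mcons (FMonom u') us').
Proof.
rewrite /= bindp_bindp; apply: eq_bindp => x y; rewrite bindp_bindp.
by apply: eq_bindp => z t; rewrite bindpU.
Qed.

(** The definition of [braid_seq] splits the left word; this is the other hexagon identity,
    splitting the right word. In the induction the crossing of [b] with [a'] and that of [u'] with
    [w] involve disjoint strands and are exchanged. *)
Lemma braid_seq_cons_r u a w (F : seq letter -> seq letter -> M) :
  bindp (bs u (a :: w)) F =
  bind (a', u') <- bsl u a; bind (w', u2) <- bs u' w; F (a' :: w') u2.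
Proof.
elim: u F => [|b u IH] F; first by rewrite [LHS]braid_seq_nil [RHS]bindpU [RHS]braid_seq_nil.
rewrite [LHS]braid_seq_cons [LHS]IH [RHS]braid_seq_letter_cons; apply: eq_bindp => a' u'.
apply/esym; apply: etrans (eq_bindp _ _) _ => [a2 b'|]; first by rewrite [LHS]braid_seq_cons.
by rewrite [LHS]bindp_exch; apply: eq_bindp => w1 u1; rewrite [RHS]braid_letter_seq_cons.
Qed.

Lemma braid_mword_cons_r n us a w (F : word -> mword n -> M) :
  bindp (braid_mword D us (FMonom (a :: w))) F =
  bind (a', us') <- bml us a;
  bind (w', us2) <- braid_mword D us' (FMonom w); F (FMonom (a' :: w')) us2.
Proof.
elim: n us a w F => [|n IH] us a w F.
  by rewrite [LHS]braid_mword0 [RHS]bindpU [RHS]braid_mword0.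
have [u [us' ->]] := mconsP us; move: us' => {}us.
rewrite [LHS]braid_mwordS [LHS]IH [RHS]braid_mword_letterS; apply: eq_bindp => a' us'.
apply/esym; apply: etrans (eq_bindp _ _) _ => [a2 u'|]; first by rewrite [LHS]braid_mwordS.
by rewrite [LHS]bindp_exch; apply: eq_bindp => w1 us1; rewrite [RHS]braid_seq_cons_r.
Qed.

Lemma braid_seq_nil_r u (F : seq letter -> seq letter -> M) : bindp (bs u [::]) F = F [::] u.
Proof.
elim: u F => [|a u IH] F; first by rewrite [LHS]braid_seq_nil.
by rewrite [LHS]braid_seq_cons [LHS]IH [LHS]braid_letter_seq_nil.
Qed.

Lemma braid_mword_nil_r n us (F : word -> mword n -> M) :
  bindp (braid_mword D us (FMonom [::])) F = F (FMonom [::]) us.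
Proof.
elim: n us F => [|n IH] us F; first by rewrite [LHS]braid_mword0.
have [u [us' ->]] := mconsP us.
by rewrite [LHS]braid_mwordS [LHS]IH [LHS]braid_seq_nil_r.
Qed.

Lemma braid_seq_letter_cat u u' a (F : letter -> seq letter -> M) :
  bindp (bsl (u ++ u') a) F =
  bind (a', u2) <- bsl u' a; bind (a2, u1) <- bsl u a'; F a2 (u1 ++ u2).
Proof.
elim: u F => [|b u IH] F.
  by apply: eq_bindp => a' u2; rewrite [RHS]bindpU.
rewrite [LHS]braid_seq_letter_cons [LHS]IH.
by apply: eq_bindp => a' u2; rewrite [RHS]braid_seq_letter_cons.
Qed.
End CPS2.
End Braid.

(** * Naturality of the braiding of words *)

Section Naturality.
Variables (K : fieldType) (q : K) (D : VV_decomposition q).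
Local Notation BL := (braid_letters D).
Local Notation bls := (braid_letter_seq D).
Local Notation bs := (braid_seq D).
Local Notation bm := (braid_mword D).
Local Notation bsl := (braid_seq_letter D).
Local Notation bml := (braid_mword_letter D).

Section At.
Variable beta : letter -> letter -> {malg K[(letter * letter)%type]}.

(** [beta] applied to the letters k and k + 1. The default 0 for short words is harmless: braiding
    preserves lengths, so both sides of a naturality statement vanish together. *)
Fixpoint at_pos (k : nat) (w : seq letter) : {malg K[seq letter]} :=
  match k, w with
  | 0, [:: a, b & w'] => bind (a', b') <- beta a b; << [:: a', b' & w'] >>
  | k'.+1, a :: w' => bind w2 <- at_pos k' w'; << a :: w2 >>
  | _, _ => 0
  end.

(* Applying beta to two adjacent letters commutes with moving a third letter
   across both; for beta = BL this is the Yang-Baxter equation. *)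
Definition braid_natural : Prop :=
  forall (M : lmodType K) (F : letter -> letter -> letter -> M) a b c,
  (bind (b', c') <- beta b c; bind (b2, a') <- BL a b';
   bind (c2, a2) <- BL a' c'; F b2 c2 a2) =
  (bind (b', a') <- BL a b; bind (c', a2) <- BL a' c;
   bind (b2, c2) <- beta b' c'; F b2 c2 a2) /\
  (bind (a', b') <- beta a b; bind (c', b2) <- BL b' c;
   bind (c2, a2) <- BL a' c'; F c2 a2 b2) =
  (bind (c', b') <- BL b c; bind (c2, a') <- BL a c';
   bind (a2, b2) <- beta a' b'; F c2 a2 b2).

Section Rules.
Variable M : lmodType K.

Lemma at_pos0 a b r (F : seq letter -> M) :
  lin F (at_pos 0 [:: a, b & r]) = bind (a', b') <- beta a b; F [:: a', b' & r].
Proof. by rewrite [LHS]lin_bindp; apply: eq_bindp => x y; rewrite [LHS]linU. Qed.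

Lemma at_posS k a w (F : seq letter -> M) :
  lin F (at_pos k.+1 (a :: w)) = bind w' <- at_pos k w; F (a :: w').
Proof. by rewrite [LHS]lin_lin; apply: eq_lin => x; rewrite [LHS]linU. Qed.

Hypothesis beta_nat : braid_natural.

(** The letter [a] meets the two letters under [beta] consecutively, and there the first half of
    [braid_natural] applies; before and after, the strands are disjoint. *)
Lemma braid_letter_seq_at_pos k a w (F : seq letter -> letter -> M) :
  (bind w' <- at_pos k w; bindp (bls a w') F) =
  bind (w1, a') <- bls a w; bind w' <- at_pos k w1; F w' a'.
Proof.
elim: k w a F => [|k IH] [|b w] a F.
- by rewrite [LHS]linear0 [RHS]braid_letter_seq_nil [RHS]linear0.
- case: w => [|c w].
    rewrite [LHS]linear0 [RHS]braid_letter_seq_cons; apply/esym.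
    apply: etrans (eq_bindp _ _) (bindp0 _ _) => b' a'.
    by rewrite [LHS]braid_letter_seq_nil [LHS]linear0.
  rewrite [LHS]at_pos0 [RHS]braid_letter_seq_cons.
  apply: etrans (eq_bindp _ _) _ => [b' c'|]; first rewrite [LHS]braid_letter_seq_cons.
    by apply: (eq_bindp _ _) => x y; rewrite [LHS]braid_letter_seq_cons.
  rewrite [LHS](beta_nat (fun b2 c2 a2 => bind (w', a3) <- bls a2 w;
     F [:: b2, c2 & w'] a3) a b c).1.
  apply: eq_bindp => b' a'; rewrite [RHS]braid_letter_seq_cons; apply: eq_bindp => c' a2.
  rewrite [LHS]bindp_exch; apply: eq_bindp => w1 a3.
  by rewrite [RHS]at_pos0.
- by rewrite [LHS]linear0 [RHS]braid_letter_seq_nil [RHS]linear0.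
- rewrite [LHS]at_posS [RHS]braid_letter_seq_cons.
  apply: etrans (eq_lin _ _) _ => [w'|]; first by rewrite [LHS]braid_letter_seq_cons.
  rewrite [LHS]lin_bindp_exch; apply: eq_bindp => b' a'.
  rewrite [LHS]IH; apply: eq_bindp => w1 a2; by rewrite [RHS]at_posS.
Qed.

Lemma braid_seq_at_pos_r k u w (F : seq letter -> seq letter -> M) :
  (bind w' <- at_pos k w; bindp (bs u w') F) =
  bind (w1, u1) <- bs u w; bind w' <- at_pos k w1; F w' u1.
Proof.
elim: u w F => [|a u IH] w F.
  rewrite [RHS]braid_seq_nil; apply: eq_lin => w'; by rewrite [LHS]braid_seq_nil.
rewrite [RHS]braid_seq_cons; apply: etrans (eq_lin _ _) _ => [w'|].
  by rewrite [LHS]braid_seq_cons.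
rewrite [LHS]IH; apply: eq_bindp => w1 u1.
by rewrite [LHS]braid_letter_seq_at_pos.
Qed.

(** Here the pair under [beta] moves across a word: the second half of [braid_natural], once per
    letter of [w]. *)
Lemma braid_letter_seq_natural a b w (F : seq letter -> letter -> letter -> M) :
  (bind (a', b') <- beta a b; bind (w1, b1) <- bls b' w;
   bind (w2, a1) <- bls a' w1; F w2 a1 b1) =
  (bind (w1, b1) <- bls b w; bind (w2, a1) <- bls a w1;
   bind (a', b') <- beta a1 b1; F w2 a' b').
Proof.
elim: w a b F => [|c w IH] a b F.
  rewrite [RHS]braid_letter_seq_nil [RHS]braid_letter_seq_nil; apply: eq_bindp => a' b'.
  by rewrite [LHS]braid_letter_seq_nil [LHS]braid_letter_seq_nil.
rewrite [RHS]braid_letter_seq_cons.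
apply: (@etrans _ _ (bind (a', b') <- beta a b; bind (c', b2) <- BL b' c;
   bind (c2, a2) <- BL a' c'; bind (w1, b3) <- bls b2 w;
   bind (w2, a3) <- bls a2 w1; F (c2 :: w2) a3 b3)).
  apply: eq_bindp => a' b'; rewrite [LHS]braid_letter_seq_cons; apply: eq_bindp => c' b2.
  rewrite [RHS]bindp_exch; apply: eq_bindp => w1 b3; by rewrite [LHS]braid_letter_seq_cons.
rewrite [LHS](beta_nat (fun c2 a2 b2 => bind (w1, b3) <- bls b2 w;
   bind (w2, a3) <- bls a2 w1; F (c2 :: w2) a3 b3) a b c).2.
apply: eq_bindp => c' b'.
apply: (@etrans _ _ (bind (c2, a') <- BL a c'; bind (w1, b1) <- bls b' w;
  bind (w2, a1) <- bls a' w1; bind (a2, b2) <- beta a1 b1; F (c2 :: w2) a2 b2)).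
  by apply: eq_bindp => c2 a'; exact: IH.
rewrite [LHS]bindp_exch; apply: eq_bindp => w1 b1; by rewrite [RHS]braid_letter_seq_cons.
Qed.

Lemma braid_seq_at_pos_l k u w (F : seq letter -> seq letter -> M) :
  (bind u' <- at_pos k u; bindp (bs u' w) F) =
  bind (w1, u1) <- bs u w; bind u' <- at_pos k u1; F w1 u'.
Proof.
elim: k u w F => [|k IH] [|a u] w F.
- by rewrite [LHS]linear0 [RHS]braid_seq_nil [RHS]linear0.
- case: u => [|b u].
    rewrite [LHS]linear0 [RHS]braid_seq_cons [RHS]braid_seq_nil; apply/esym.
    apply: etrans (eq_bindp _ _) (bindp0 _ _) => w1 a1.
    by rewrite [LHS]linear0.
  rewrite [LHS]at_pos0 [RHS]braid_seq_cons [RHS]braid_seq_cons.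
  apply: (@etrans _ _ (bind (w', u') <- bs u w; bind (a', b') <- beta a b;
     bind (w1, b1) <- bls b' w'; bind (w2, a1) <- bls a' w1; F w2 [:: a1, b1 & u'])).
    rewrite [RHS]bindp_exch; apply: eq_bindp => a' b'.
    by rewrite [LHS]braid_seq_cons [LHS]braid_seq_cons.
  apply: eq_bindp => w' u'.
  rewrite [LHS](braid_letter_seq_natural a b w' (fun w2 a1 b1 => F w2 [:: a1, b1 & u'])).
  apply: eq_bindp => w1 b1; apply: eq_bindp => w2 a1; by rewrite [RHS]at_pos0.
- by rewrite [LHS]linear0 [RHS]braid_seq_nil [RHS]linear0.
- rewrite [LHS]at_posS [RHS]braid_seq_cons.
  apply: etrans (eq_lin _ _) _ => [u'|]; first by rewrite [LHS]braid_seq_cons.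
  rewrite [LHS]IH; apply: eq_bindp => w1 u1.
  rewrite [LHS]lin_bindp_exch; apply: eq_bindp => w2 a1; by rewrite [RHS]at_posS.
Qed.

(** The mirror situation, a pair moving leftwards across [u], uses the first half of
    [braid_natural]. *)
Lemma braid_seq_letter_natural u b a (F : letter -> letter -> seq letter -> M) :
  (bind (c, e) <- beta b a; bind (c', u1) <- bsl u c;
   bind (e', u2) <- bsl u1 e; F c' e' u2) =
  (bind (b', u1) <- bsl u b; bind (a', u2) <- bsl u1 a;
   bind (c, e) <- beta b' a'; F c e u2).
Proof.
elim: u b a F => [|x u IH] b a F.
  rewrite [RHS]bindpU [RHS]bindpU; apply: eq_bindp => c e.
  by rewrite [LHS]bindpU [LHS]bindpU.
apply: (@etrans _ _ (bind (c, e) <- beta b a; bind (c1, u1) <- bsl u c;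
  bind (e1, u2) <- bsl u1 e; bind (c2, x1) <- BL x c1; bind (e2, x2) <- BL x1 e1;
  F c2 e2 (x2 :: u2))).
  apply: eq_bindp => c e; rewrite [LHS]braid_seq_letter_cons; apply: eq_bindp => c1 u1.
  rewrite [RHS]bindp_exch; apply: eq_bindp => c2 x1; by rewrite [LHS]braid_seq_letter_cons.
rewrite [LHS](IH b a (fun c1 e1 u2 => bind (c2, x1) <- BL x c1;
  bind (e2, x2) <- BL x1 e1; F c2 e2 (x2 :: u2))) [RHS]braid_seq_letter_cons.
apply: eq_bindp => b1 u1.
apply: (@etrans _ _ (bind (a1, u2) <- bsl u1 a; bind (b2, x1) <- BL x b1;
   bind (a2, x2) <- BL x1 a1; bind (c, e) <- beta b2 a2; F c e (x2 :: u2))).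
  apply: eq_bindp => a1 u2.
  exact: (beta_nat (fun c2 e2 x2 => F c2 e2 (x2 :: u2)) x b1 a1).1.
rewrite [LHS]bindp_exch; apply: eq_bindp => b2 x1; by rewrite [RHS]braid_seq_letter_cons.
Qed.

Lemma braid_mword_letter_natural n us b a (F : letter -> letter -> mword n -> M) :
  (bind (c, e) <- beta b a; bind (c', us1) <- bml us c;
   bind (e', us2) <- bml us1 e; F c' e' us2) =
  (bind (b', us1) <- bml us b; bind (a', us2) <- bml us1 a;
   bind (c, e) <- beta b' a'; F c e us2).
Proof.
elim: n us b a F => [|n IH] us b a F.
  rewrite [RHS]bindpU [RHS]bindpU; apply: eq_bindp => c e.
  by rewrite [LHS]bindpU [LHS]bindpU.
have [u [us' ->]] := mconsP us; move: us' => {}us.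
apply: (@etrans _ _ (bind (c, e) <- beta b a; bind (c1, us1) <- bml us c;
  bind (e1, us2) <- bml us1 e; bind (c2, u1) <- bsl u c1; bind (e2, u2) <- bsl u1 e1;
  F c2 e2 (mcons (FMonom u2) us2))).
  apply: eq_bindp => c e; rewrite [LHS]braid_mword_letterS; apply: eq_bindp => c1 us1.
  rewrite [RHS]bindp_exch; apply: eq_bindp => c2 u1; by rewrite [LHS]braid_mword_letterS.
rewrite [LHS](IH us b a (fun c1 e1 us2 => bind (c2, u1) <- bsl u c1;
  bind (e2, u2) <- bsl u1 e1; F c2 e2 (mcons (FMonom u2) us2))) [RHS]braid_mword_letterS.
apply: eq_bindp => b1 us1.
apply: (@etrans _ _ (bind (a1, us2) <- bml us1 a; bind (b2, u1) <- bsl u b1;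
   bind (a2, u2) <- bsl u1 a1; bind (c, e) <- beta b2 a2;
   F c e (mcons (FMonom u2) us2))).
  apply: eq_bindp => a1 us2.
  exact: (braid_seq_letter_natural u b1 a1 (fun c e u2 => F c e (mcons (FMonom u2) us2))).
rewrite [LHS]bindp_exch; apply: eq_bindp => b2 u1; by rewrite [RHS]braid_mword_letterS.
Qed.

Lemma braid_mword_at_pos n k us w (F : word -> mword n -> M) :
  (bind w' <- at_pos k w; bindp (bm us (FMonom w')) F) =
  bind (w1, us1) <- bm us (FMonom w); bind w' <- at_pos k w1; F (FMonom w') us1.
Proof.
elim: n us w F => [|n IH] us w F.
  by rewrite [RHS]braid_mword0; apply: eq_lin => w'; rewrite [LHS]braid_mword0.
have [u [us' ->]] := mconsP us; move: us' => {}us.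
rewrite [RHS]braid_mwordS; apply: etrans (eq_lin _ _) _ => [w'|]; first by rewrite [LHS]braid_mwordS.
rewrite [LHS](IH us w (fun w' us' => bind (w2, u') <- bs u w';
  F (FMonom w2) (mcons (FMonom u') us'))).
by apply: eq_bindp => w1 us1; rewrite [LHS]braid_seq_at_pos_r.
Qed.

End Rules.
End At.
End Naturality.

(** * The ideal of relations *)

Section Ideal.
Variables (K : fieldType) (q : K) (D : VV_decomposition q).
Local Notation BL := (braid_letters D).
Local Notation bls := (braid_letter_seq D).
Local Notation bs := (braid_seq D).
Local Notation bm := (braid_mword D).
Variable CL : letter -> letter -> {malg K[(letter * letter)%type]}.
Hypothesis CL_nat : braid_natural D CL.
Hypothesis CL_wedge2 : forall a b, exists2 u, (u <= wedge2 D)%MS &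
  TV_of_VV u = bind (c, e) <- CL a b; << FMonom [:: c; e] >>.
Hypothesis wedge2_CL : forall u, (u <= wedge2 D)%MS -> exists x,
  TV_of_VV u = bind (a, b) <- x; bind (c, e) <- CL a b; << FMonom [:: c; e] >>.

Definition lclosed (M : lmodType K) (P : M -> Prop) : Prop :=
  P 0 /\ forall a u v, P u -> P v -> P (a *: u + v).

Lemma lclosed_lin (G : choiceType) (M : lmodType K) (P : M -> Prop) (f : G -> M) x :
  lclosed P -> (forall g, P (f g)) -> P (lin f x).
Proof. by case=> P0 PD; exact: lin_closed. Qed.

Lemma lclosed_bindp (G H : choiceType) (M : lmodType K) (P : M -> Prop)
    (f : G -> H -> M) x :
  lclosed P -> (forall a b, P (f a b)) -> P (bindp x f).
Proof. by move=> cP Pf; apply: lclosed_lin cP _ => -[a b]; exact: Pf. Qed.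

Lemma Sq_ideal_closed : lclosed (Sq_ideal D).
Proof. by split; [exact: lspan0 | exact: lspanP]. Qed.

Lemma Am_ker_closed m : lclosed (@Am_ker _ _ D m).
Proof. by split; [exact: Am_ker0 | exact: Am_kerP]. Qed.

Lemma lin_mul (M : lmodType K) (F : word -> M) (x y : TV K) :
  lin F (x * y) = bind u <- x; bind w <- y; F (mmul u w).
Proof.
have linC c (u : word) : lin F << c *g u >> = c *: F u.
  by rewrite (linEw _ msuppU_le) big_seq_fset1 mcoeffUU.
rewrite malgM_def /fgmul [LHS](raddf_sum (lin F)); apply: eq_bigr => u _.
rewrite [LHS](raddf_sum (lin F)) [X in _ = _ *: X]/lin scaler_sumr.
by apply: eq_bigr => w _; rewrite [LHS]linC scalerA.
Qed.

Lemma at_posP k (w : seq letter) :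
  (exists (p : seq letter) a b r, w = cat p [:: a, b & r] /\
     forall (M : lmodType K) (F : seq letter -> M),
     lin F (at_pos CL k w) = bind (a', b') <- CL a b; F (cat p [:: a', b' & r])) \/
  forall (M : lmodType K) (F : seq letter -> M), lin F (at_pos CL k w) = 0.
Proof.
elim: k w => [|k IH] [|a w]; try by right=> M F; rewrite [LHS]linear0.
  case: w => [|b w]; first by right=> M F; rewrite [LHS]linear0.
  by left; exists [::], a, b, w; split=> // M F; rewrite [LHS]at_pos0.
case: (IH w) => [[p [b [c [r [-> E]]]]]|E].
  by left; exists (a :: p), b, c, r; split=> // M F; rewrite [LHS]at_posS [LHS]E.
by right=> M F; rewrite [LHS]at_posS [LHS]E.
Qed.

Lemma at_pos_cat (p : seq letter) a b r (M : lmodType K) (F : seq letter -> M) :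
  lin F (at_pos CL (size p) (cat p [:: a, b & r])) =
  bind (a', b') <- CL a b; F (cat p [:: a', b' & r]).
Proof.
elim: p F => [|c p IH] F; first by rewrite [LHS]at_pos0.
by rewrite [LHS]at_posS [LHS]IH.
Qed.

Lemma Sq_ideal_at_pos k w : Sq_ideal D (bind w' <- at_pos CL k w; << FMonom w' >>).
Proof.
case: (at_posP k w) => [[p [a [b [r [_ ->]]]]]|->]; last exact: lspan0.
have [u uW Eu] := CL_wedge2 a b.
move=> P P0 PD PG; apply: PG; exists << FMonom p >>, u, << FMonom r >>.
split; first exact: uW.
apply: etrans (malg_sum (<< FMonom p >> * TV_of_VV u * << FMonom r >> : TV K)).
rewrite [RHS](lin_mul _ (<< FMonom p >> * TV_of_VV u : TV K)).
rewrite [RHS](lin_mul _ << FMonom p >> (TV_of_VV u)).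
rewrite Eu [RHS]linU.
rewrite [RHS]lin_bindp; apply: eq_bindp => a' b'.
by rewrite [RHS]linU [RHS]linU !mmul_word /= -catA.
Qed.

(** [lspan] is the least linearly closed predicate, so it suffices that the preimage of [P] under
    [lin F] is closed. *)
Lemma lspan_lin (G : choiceType) (M : lmodType K) (P : M -> Prop) (F : G -> M)
    (S : {malg K[G]} -> Prop) z :
  lclosed P -> (forall x, S x -> P (lin F x)) -> lspan S z -> P (lin F z).
Proof.
move=> [P0 PD] PS Sz; apply: (Sz (fun z => P (lin F z))) => //.
  by rewrite linear0.
by move=> a u v Pu Pv; rewrite linearP; apply: PD.
Qed.

(** Since the image of [CL] is [wedge2], the ideal is spanned by words with [CL] applied at two
    adjacent letters. Membership questions about the ideal thereby reduce to moving [at_pos CL k]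
    through the braiding. *)
Lemma Sq_ideal_lin (M : lmodType K) (P : M -> Prop) (F : word -> M) z :
  lclosed P -> (forall k w, P (bind w' <- at_pos CL k w; F (FMonom w'))) ->
  Sq_ideal D z -> P (lin F z).
Proof.
move=> cP PF; apply: lspan_lin => // _ [x [u [y [uW ->]]]]; have [t ->] := wedge2_CL uW.
rewrite [X in P X](lin_mul F (x * _) y) [X in P X](lin_mul _ x).
apply: (lclosed_lin _ cP) => -[p].
rewrite lin_bindp; apply: (lclosed_bindp _ cP) => a b; rewrite [X in P X]lin_bindp.
rewrite (@eq_bindp _ _ _ _ _ _ (fun c e =>
   @lin K word M (fun w => F (FMonom (cat p [:: c, e & fmonom_val w]))) y)); last first.
  move=> c e; rewrite [LHS]linU; apply: eq_lin => w.
  by rewrite !mmul_word /= -catA.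
rewrite -[X in P X]lin_bindp_exch; apply: (lclosed_lin _ cP) => -[w].
by rewrite -(at_pos_cat p a b w (fun v => F (FMonom v))); apply: PF.
Qed.

(** With I the ideal, the braiding maps T(V)^{(x) n} (x) I into I (x) T(V)^{(x) n}, because
    [at_pos CL k] on the right word passes through by naturality. The predicate [P] stands for
    membership in any subspace that contains the result. *)
Lemma Sq_ideal_braid_mword (M : lmodType K) (P : M -> Prop) n us (F : word -> mword n -> M) z :
  lclosed P -> (forall us' z', Sq_ideal D z' -> P (bind w <- z'; F w us')) ->
  Sq_ideal D z -> P (bind w <- z; bindp (bm us w) F).
Proof.
move=> cP PF; apply: Sq_ideal_lin => // k w; rewrite [X in P X](braid_mword_at_pos CL_nat).
apply: (lclosed_bindp _ cP) => -[w1] us1.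
have := PF us1 _ (Sq_ideal_at_pos k w1); rewrite [X in P X -> _]lin_lin.
by rewrite [X in P X -> _](@eq_lin _ _ _ _ (fun w' => F (FMonom w') us1)) // => w'; rewrite linU.
Qed.

Lemma Sq_ideal_braid_seq (M : lmodType K) (P : M -> Prop) w (F : seq letter -> word -> M) z :
  lclosed P -> (forall w' z', Sq_ideal D z' -> P (bind u <- z'; F w' u)) ->
  Sq_ideal D z ->
  P (@lin K word M (fun u => bind (w', u') <- bs u w; F w' (FMonom u')) z).
Proof.
move=> cP PF; apply: Sq_ideal_lin => // k u.
rewrite [X in P X](braid_seq_at_pos_l CL_nat k u w (fun w' u' => F w' (FMonom u'))).
apply: (lclosed_bindp _ cP) => w1 u1.
have := PF w1 _ (Sq_ideal_at_pos k u1); rewrite [X in P X -> _]lin_lin.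
by rewrite [X in P X -> _](@eq_lin _ _ _ _ (fun u' => F w1 (FMonom u'))) // => u'; rewrite linU.
Qed.

Lemma Am_ker_tensl n x (y : TVm K n) : Sq_ideal D x -> Am_ker D (tens x y : TVm K n.+1).
Proof. by move=> Sx P P0 PD PG; apply: PG; exists x, y; split=> //; left. Qed.

Lemma Am_ker_tensr n x (y : TVm K n) : Am_ker D y -> Am_ker D (tens x y : TVm K n.+1).
Proof. by move=> ky P P0 PD PG; apply: PG; exists x, y; split=> //; right. Qed.

Lemma Am_ker_lin (M : lmodType K) (P : M -> Prop) n (F : mword n.+1 -> M) z :
  lclosed P ->
  (forall x us, Sq_ideal D x -> P (bind u <- x; F (mcons u us))) ->
  (forall u (y : TVm K n), Am_ker D y -> P (bind us <- y; F (mcons u us))) ->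
  Am_ker D z -> P (lin F z).
Proof.
move=> cP PS PK; apply: lspan_lin => // _ [x [y [k ->]]]; rewrite [X in P X]tensE; case: k => [Sx|ky].
  by rewrite [X in P X]lin_exch; apply: (lclosed_lin _ cP) => us; exact: PS.
by apply: (lclosed_lin _ cP) => u; exact: PK.
Qed.

(** The kernel is a sum over the tensor factors of terms with one entry in the ideal. That entry
    stays in its own factor when [w] crosses, by [Sq_ideal_braid_seq] for the first factor and by
    induction for the others. *)
Lemma Am_ker_braid_mword (M : lmodType K) (P : M -> Prop) n w (F : word -> mword n -> M) z :
  lclosed P -> (forall w' z', Am_ker D z' -> P (bind us <- z'; F w' us)) ->
  Am_ker D z -> P (bind us <- z; bindp (bm us w) F).
Proof.
elim: n w F z => [|n IH] w F z cP PF.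
  by move=> /= ->; rewrite linear0; case: cP.
apply: Am_ker_lin => // [x us Sx|u y ky].
  rewrite (@eq_lin K word M _ (fun u => bind (w', us') <- bm us w;
     bind (w2, u') <- bs u w'; F (FMonom w2) (mcons (FMonom u') us'))); last first.
    by move=> u; rewrite [LHS]braid_mwordS.
  rewrite [X in P X]lin_bindp_exch; apply: (lclosed_bindp _ cP) => w' us'.
  apply: (@Sq_ideal_braid_seq _ P w' (fun w2 u' => F (FMonom w2) (mcons u' us'))) => // w2 z' Sz'.
  have := PF (FMonom w2) _ (Am_ker_tensl << us' >> Sz'); rewrite [X in P X -> _]tensE.
  by rewrite [X in P X -> _](@eq_lin _ _ _ _ (fun u' => F (FMonom w2) (mcons u' us'))) // => u'; rewrite linU.
rewrite (@eq_lin _ _ _ _ (fun us => bind (w', us') <- bm us w;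
   bind (w2, u') <- bs u w'; F (FMonom w2) (mcons (FMonom u') us'))); last first.
  by move=> us; rewrite [LHS]braid_mwordS.
apply: (IH w (fun w' us' => bind (w2, u') <- bs u w'; F (FMonom w2) (mcons (FMonom u') us'))) => //.
move=> w' z' kz'; rewrite [X in P X]lin_bindp_exch; apply: (lclosed_bindp _ cP) => w2 u'.
have := PF (FMonom w2) _ (Am_ker_tensr << FMonom u' >> kz').
by rewrite [X in P X -> _]tensE [X in P X -> _]linU.
Qed.

Lemma Sq_ideal_mulr w' x : Sq_ideal D x ->
  Sq_ideal D (bind u <- x; << mmul u w' >>).
Proof.
apply: (@Sq_ideal_lin _ (Sq_ideal D) (fun u => << mmul u w' >>) x Sq_ideal_closed) => k w.
case: (at_posP k w) => [[p [a [b [r [_ ->]]]]]|->]; last exact: lspan0.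
have := Sq_ideal_at_pos (size p) (cat p [:: a, b & cat r w']); rewrite at_pos_cat => Sg.
apply: (eq_ind _ (Sq_ideal D) Sg); apply: eq_bindp => a' b'.
by rewrite mmul_word /= -catA.
Qed.

Lemma Sq_ideal_mull w' x : Sq_ideal D x ->
  Sq_ideal D (bind u <- x; << mmul w' u >>).
Proof.
apply: (@Sq_ideal_lin _ (Sq_ideal D) (fun u => << mmul w' u >>) x Sq_ideal_closed) => k w.
case: (at_posP k w) => [[p [a [b [r [_ ->]]]]]|->]; last exact: lspan0.
have := Sq_ideal_at_pos (size (cat w' p)) (cat (cat w' p) [:: a, b & r]); rewrite at_pos_cat => Sg.
apply: (eq_ind _ (Sq_ideal D) Sg); apply: eq_bindp => a' b'.
by rewrite mmul_word /= -catA.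
Qed.

Lemma tens_linl (G H I : choiceType) (f : G -> {malg K[H]}) x (y : {malg K[I]}) :
  (bind u <- x; tens (f u) y) = tens (lin f x) y.
Proof. by rewrite [RHS]lin_lin. Qed.

Lemma tens_linr (G H I : choiceType) (f : G -> {malg K[H]}) x (u : I) :
  (bind g <- x; tens << u >> (f g)) = tens << u >> (lin f x).
Proof.
rewrite /tens /lin2 [RHS]linU [RHS]lin_lin; apply: eq_lin => g.
by rewrite [LHS]linU.
Qed.

Lemma mword_mulS n u us w ws :
  mword_mul D (mcons u us : mword n.+1) (mcons w ws) =
  bind (w', us') <- bm us w; tens << mmul u w' >> (mword_mul D us' ws).
Proof. by []. Qed.

(** If the first entry of [x] is in the ideal, it is only multiplied on the right. Otherwise the
    remaining entries cross the first word of [y], which keeps them in the kernel, and the induction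
    hypothesis handles their product. *)
Lemma Am_ker_mull n (x y : TVm K n) : Am_ker D x -> Am_ker D (TVm_mul D x y).
Proof.
elim: n x y => [|n IH] x y; first by move=> /= ->; rewrite /TVm_mul /lin2 linear0.
have kc := Am_ker_closed n.+1.
rewrite /TVm_mul /lin2 [X in _ -> @Am_ker _ _ _ n.+1 X]lin_exch => kx.
apply: (lclosed_lin _ kc) => ww; have [w [ws ->]] := mconsP ww.
apply: (Am_ker_lin kc _ _ kx) => [{x kx} x us Sx|u {x kx} x kx].
  rewrite [X in @Am_ker _ _ _ n.+1 X](@eq_lin _ _ _ _ _ _ (fun u => mword_mulS u us _ ws)).
  rewrite [X in @Am_ker _ _ _ n.+1 X]lin_bindp_exch.
  apply: (lclosed_bindp _ kc) => w' us'; rewrite [X in @Am_ker _ _ _ n.+1 X]tens_linl.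
  by apply: Am_ker_tensl; apply: Sq_ideal_mulr.
rewrite [X in @Am_ker _ _ _ n.+1 X](@eq_lin _ _ _ _ _ _ (fun us => mword_mulS u us _ ws)).
apply: (@Am_ker_braid_mword _ (@Am_ker _ _ D n.+1) n (FMonom w)
  (fun w' us' => tens << mmul u w' >> (mword_mul D us' ws)) x kc _ kx).
move=> w' z' kz'; rewrite [X in @Am_ker _ _ _ n.+1 X]tens_linr; apply: Am_ker_tensr.
have := IH z' << ws >> kz'; rewrite /TVm_mul /lin2.
by rewrite [X in Am_ker _ X -> _](@eq_lin _ _ _ _ _ _ (fun us => linU _ ws)).
Qed.

Lemma Am_ker_mulr n (x y : TVm K n) : Am_ker D y -> Am_ker D (TVm_mul D x y).
Proof.
elim: n x y => [|n IH] x y.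
  move=> /= ->; rewrite /TVm_mul /lin2.
  by rewrite (@eq_lin _ _ _ _ _ _ (fun us => linear0 _)) lin0.
have kc := Am_ker_closed n.+1; move=> ky; rewrite /TVm_mul /lin2.
apply: (lclosed_lin _ kc) => uu; have [u [us ->]] := mconsP uu.
apply: (Am_ker_lin kc _ _ ky) => [{y ky} y ws Sy|w {y ky} y ky].
  rewrite [X in @Am_ker _ _ _ n.+1 X](@eq_lin _ _ _ _ _ _ (fun w => mword_mulS _ us w ws)).
  apply: (@Sq_ideal_braid_mword _ (@Am_ker _ _ D n.+1) n us
    (fun w' us' => tens << mmul (FMonom u) w' >> (mword_mul D us' ws)) y kc _ Sy).
  move=> us' z' Sz'; rewrite [X in @Am_ker _ _ _ n.+1 X]tens_linl.
  by apply: Am_ker_tensl; apply: Sq_ideal_mull.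
rewrite [X in @Am_ker _ _ _ n.+1 X](@eq_lin _ _ _ _ _ _ (fun ws => mword_mulS _ us w ws)).
rewrite [X in @Am_ker _ _ _ n.+1 X]lin_bindp_exch.
apply: (lclosed_bindp _ kc) => w' us'; rewrite [X in @Am_ker _ _ _ n.+1 X]tens_linr.
apply: Am_ker_tensr; have := IH << us' >> y ky.
by rewrite /TVm_mul /lin2 [X in Am_ker _ X -> _]linU.
Qed.

Lemma TVm_mul_linl m : forall y : TVm K m, linear (fun x => TVm_mul D x y).
Proof. by move=> y a u v; rewrite /TVm_mul /lin2 linearP. Qed.

Lemma TVm_mul_linr m : forall x : TVm K m, linear (fun y => TVm_mul D x y).
Proof.
move=> x a u v; rewrite /TVm_mul /lin2 [LHS]lin_exch ![in RHS](lin_exch _ x).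
by rewrite linearP.
Qed.

(** The representatives are replaced one at a time, each change costing an element of the kernel. *)
Lemma Am_mulE m (x y : TVm K m) :
  Am_mul (Am_of D x) (Am_of D y) = Am_of D (TVm_mul D x y).
Proof.
rewrite /Am_mul -lock; set x' := repr (Am_of D x); set y' := repr (Am_of D y).
have kx : Am_ker D (x' - x) by apply: Am_of_ker; rewrite Am_repr.
have ky : Am_ker D (y' - y) by apply: Am_of_ker; rewrite Am_repr.
transitivity (Am_of D (TVm_mul D x' y')); first by [].
transitivity (Am_of D (TVm_mul D x y')); apply: Am_of_eq.
  have := Am_ker_mull y' kx; rewrite -[x' - x]addrC -scaleN1r.
  by rewrite (TVm_mul_linl y' (-1) x x') scaleN1r addrC.
have := Am_ker_mulr x ky; rewrite -[y' - y]addrC -scaleN1r.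
by rewrite (TVm_mul_linr x (-1) y y') scaleN1r addrC.
Qed.

End Ideal.

(** * Coordinates *)

Section Tables.
Local Open Scope Z_scope.
(* Row a, column b: the image of v_a (x) v_b under Rcheck. *)
Definition tab_braid : seq (seq tensor) :=
  [:: [:: [:: ([:: v1; v1], [:: (2, 1)])];
      [:: ([:: v2; v1], [:: (1, 1)])];
      [:: ([:: v3; v1], [:: (1, 1)])];
      [:: ([:: v0; v1], [:: (0, 1)])];
      [:: ([:: vm3; v1], [:: (-1, 1)])];
      [:: ([:: vm2; v1], [:: (-1, 1)])];
      [:: ([:: vm1; v1], [:: (-2, 1)])]];
    [:: [:: ([:: v1; v2], [:: (1, 1)]);
        ([:: v2; v1], [:: (0, -1); (2, 1)])];
      [:: ([:: v2; v2], [:: (2, 1)])];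
      [:: ([:: v3; v2], [:: (-1, 1)]);
        ([:: v0; v1], [:: (-1, -1); (1, 1)])];
      [:: ([:: v0; v2], [:: (0, 1)]);
        ([:: vm3; v1], [:: (-2, 1); (0, -1)])];
      [:: ([:: vm3; v2], [:: (1, 1)])];
      [:: ([:: vm2; v2], [:: (-2, 1)]);
        ([:: vm1; v1], [:: (-3, 1); (-1, -1)])];
      [:: ([:: vm1; v2], [:: (-1, 1)])]];
    [:: [:: ([:: v1; v3], [:: (1, 1)]);
        ([:: v3; v1], [:: (0, -1); (2, 1)])];
      [:: ([:: v2; v3], [:: (-1, 1)]);
        ([:: v3; v2], [:: (-4, -1); (2, 1)]);
        ([:: v0; v1], [:: (-4, 1); (-2, -1)])];
      [:: ([:: v3; v3], [:: (2, 1)])];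
      [:: ([:: v0; v3], [:: (0, 1)]);
        ([:: vm2; v1], [:: (-2, -1); (0, 1)])];
      [:: ([:: vm3; v3], [:: (-2, 1)]);
        ([:: vm2; v2], [:: (-5, 1); (1, -1)]);
        ([:: vm1; v1], [:: (-6, 1); (-4, -1)])];
      [:: ([:: vm2; v3], [:: (1, 1)])];
      [:: ([:: vm1; v3], [:: (-1, 1)])]];
    [:: [:: ([:: v1; v0], [:: (0, 1)]);
        ([:: v2; v3], [:: (-3, -1); (1, 1)]);
        ([:: v3; v2], [:: (-6, 1); (-2, -1)]);
        ([:: v0; v1], [:: (-6, -1); (-4, 1); (0, -1); (2, 1)])];
      [:: ([:: v2; v0], [:: (0, 1)]);
        ([:: v0; v2], [:: (-2, -1); (2, 1)]);
        ([:: vm3; v1], [:: (-4, -1); (-2, 1)])];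
      [:: ([:: v3; v0], [:: (0, 1)]);
        ([:: v0; v3], [:: (-2, -1); (2, 1)]);
        ([:: vm2; v1], [:: (-4, 1); (-2, -1)])];
      [:: ([:: v0; v0], [:: (0, 1)]);
        ([:: vm3; v3], [:: (-4, 1); (0, -1)]);
        ([:: vm2; v2], [:: (-7, 1); (-3, -1)]);
        ([:: vm1; v1], [:: (-8, 1); (-6, -1); (-2, 1); (0, -1)])];
      [:: ([:: vm3; v0], [:: (0, 1)]);
        ([:: vm1; v2], [:: (-3, -1); (1, 1)])];
      [:: ([:: vm2; v0], [:: (0, 1)]);
        ([:: vm1; v3], [:: (-3, 1); (1, -1)])];
      [:: ([:: vm1; v0], [:: (0, 1)])]];
    [:: [:: ([:: v1; vm3], [:: (-1, 1)]);
        ([:: v2; v0], [:: (-2, 1); (2, -1)]);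
        ([:: v0; v2], [:: (-4, -1); (0, 1)]);
        ([:: vm3; v1], [:: (-6, -1); (-2, 1); (0, -1); (2, 1)])];
      [:: ([:: v2; vm3], [:: (1, 1)]);
        ([:: vm3; v2], [:: (0, -1); (2, 1)])];
      [:: ([:: v3; vm3], [:: (-2, 1)]);
        ([:: v0; v0], [:: (-2, 1); (2, -1)]);
        ([:: vm3; v3], [:: (-4, 1); (-2, -1); (0, -1); (2, 1)]);
        ([:: vm2; v2], [:: (-7, 1); (-5, -1)]);
        ([:: vm1; v1], [:: (-8, 1); (-6, -1); (-4, 1); (0, -1)])];
      [:: ([:: v0; vm3], [:: (0, 1)]);
        ([:: vm3; v0], [:: (-2, -1); (2, 1)]);
        ([:: vm1; v2], [:: (-5, 1); (-1, -1)])];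
      [:: ([:: vm3; vm3], [:: (2, 1)])];
      [:: ([:: vm2; vm3], [:: (-1, 1)]);
        ([:: vm1; v0], [:: (-2, -1); (2, 1)])];
      [:: ([:: vm1; vm3], [:: (1, 1)])]];
    [:: [:: ([:: v1; vm2], [:: (-1, 1)]);
        ([:: v3; v0], [:: (-2, -1); (2, 1)]);
        ([:: v0; v3], [:: (-4, 1); (0, -1)]);
        ([:: vm2; v1], [:: (-6, -1); (-2, 1); (0, -1); (2, 1)])];
      [:: ([:: v2; vm2], [:: (-2, 1)]);
        ([:: v3; vm3], [:: (-5, 1); (1, -1)]);
        ([:: v0; v0], [:: (-5, 1); (-1, -1)]);
        ([:: vm3; v3], [:: (-7, 1); (-5, -1)]);
        ([:: vm2; v2], [:: (-10, 1); (-8, -1); (0, -1); (2, 1)]);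
        ([:: vm1; v1], [:: (-11, 1); (-9, -1); (-7, 1); (-3, -1)])];
      [:: ([:: v3; vm2], [:: (1, 1)]);
        ([:: vm2; v3], [:: (0, -1); (2, 1)])];
      [:: ([:: v0; vm2], [:: (0, 1)]);
        ([:: vm2; v0], [:: (-2, -1); (2, 1)]);
        ([:: vm1; v3], [:: (-5, -1); (-1, 1)])];
      [:: ([:: vm3; vm2], [:: (-1, 1)]);
        ([:: vm2; vm3], [:: (-4, -1); (2, 1)]);
        ([:: vm1; v0], [:: (-5, 1); (-1, -1)])];
      [:: ([:: vm2; vm2], [:: (2, 1)])];
      [:: ([:: vm1; vm2], [:: (1, 1)])]];
    [:: [:: ([:: v1; vm1], [:: (-2, 1)]);
        ([:: v2; vm2], [:: (-3, 1); (-1, -1)]);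
        ([:: v3; vm3], [:: (-6, 1); (-4, -1)]);
        ([:: v0; v0], [:: (-6, 1); (-4, -1); (0, 1); (2, -1)]);
        ([:: vm3; v3], [:: (-8, 1); (-6, -1); (-4, 1); (0, -1)]);
        ([:: vm2; v2], [:: (-11, 1); (-9, -1); (-7, 1); (-3, -1)]);
        ([:: vm1; v1], [:: (-12, 1); (-10, -1); (-8, 1); (-6, -1); (-4, -1); (-2, 1); (0, -1); (2, 1)])];
      [:: ([:: v2; vm1], [:: (-1, 1)]);
        ([:: v0; vm3], [:: (-1, -1); (1, 1)]);
        ([:: vm3; v0], [:: (-3, 1); (-1, -1)]);
        ([:: vm1; v2], [:: (-6, -1); (-2, 1); (0, -1); (2, 1)])];
      [:: ([:: v3; vm1], [:: (-1, 1)]);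
        ([:: v0; vm2], [:: (-1, 1); (1, -1)]);
        ([:: vm2; v0], [:: (-3, -1); (-1, 1)]);
        ([:: vm1; v3], [:: (-6, -1); (-2, 1); (0, -1); (2, 1)])];
      [:: ([:: v0; vm1], [:: (0, 1)]);
        ([:: vm3; vm2], [:: (-2, -1); (0, 1)]);
        ([:: vm2; vm3], [:: (-5, 1); (-3, -1)]);
        ([:: vm1; v0], [:: (-6, -1); (-4, 1); (0, -1); (2, 1)])];
      [:: ([:: vm3; vm1], [:: (1, 1)]);
        ([:: vm1; vm3], [:: (0, -1); (2, 1)])];
      [:: ([:: vm2; vm1], [:: (1, 1)]);
        ([:: vm1; vm2], [:: (0, -1); (2, 1)])];
      [:: ([:: vm1; vm1], [:: (2, 1)])]]].

Definition tab_phi : tensor :=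
  [:: ([:: v1; vm1], [:: (4, 1)]); ([:: v2; vm2], [:: (3, 1)]);
      ([:: v3; vm3], [:: (0, 1)]); ([:: v0; v0], [:: (0, 1)]);
      ([:: vm3; v3], [:: (-2, 1)]); ([:: vm2; v2], [:: (-5, 1)]);
      ([:: vm1; v1], [:: (-6, 1)])].

Definition lmono (e : Z) : laurent := [:: (e, 1)].
Definition lopp (p : laurent) : laurent := [seq (x.1, - x.2) | x <- p].
Definition lbracket2 : laurent := [:: (-1, 1); (1, 1)].

Definition tab_rho (g : Uq_gen) : seq tensor :=
  let z := [::] in
  let e a c : tensor := [:: ([:: a], c)] in
  let k (s : seq Z) := [seq e x.1 (lmono x.2) | x <- zip [:: v1; v2; v3; v0; vm3; vm2; vm1] s] in
  match g with
  | E1 => [:: z; e v1 (lmono 0); z; e v3 lbracket2; e v0 (lopp lbracket2); z; e vm2 (lopp (lmono 0))]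
  | E2 => [:: z; z; e v2 (lmono 0); z; z; e vm3 (lopp (lmono 0)); z]
  | F1 => [:: e v2 (lmono 0); z; e v0 (lmono 0); e vm3 (lopp (lmono 0)); z; e vm1 (lopp (lmono 0)); z]
  | F2 => [:: z; e v3 (lmono 0); z; z; e vm2 (lopp (lmono 0)); z; z]
  | K1 => k [:: 1; -1; 2; 0; -2; 1; -1]
  | K2 => k [:: 0; 3; -3; 0; 3; -3; 0]
  | K1V => k [:: -1; 1; -2; 0; 2; -1; 1]
  | K2V => k [:: 0; -3; 3; 0; -3; 3; 0]
  end.
End Tables.

Definition row_braid (a b : letter) : tensor := nth [::] (nth [::] tab_braid a) b.
Definition row_rho (g : Uq_gen) (a : letter) : tensor := nth [::] (tab_rho g) a.
Definition tprod (T S : tensor) : tensor :=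
  [seq (x.1 ++ y.1, lmul x.2 y.2) | x <- T, y <- S].
Definition row_id (a : letter) : tensor := [:: ([:: a], lmono Z0)].
Definition row_rho2 (g : Uq_gen) (a b : letter) : tensor :=
  match g with
  | E1 => tadd (tprod (row_rho E1 a) (row_rho K1 b)) (tprod (row_id a) (row_rho E1 b))
  | E2 => tadd (tprod (row_rho E2 a) (row_rho K2 b)) (tprod (row_id a) (row_rho E2 b))
  | F1 => tadd (tprod (row_rho F1 a) (row_id b)) (tprod (row_rho K1V a) (row_rho F1 b))
  | F2 => tadd (tprod (row_rho F2 a) (row_id b)) (tprod (row_rho K2V a) (row_rho F2 b))
  | _ => tprod (row_rho g a) (row_rho g b)
  end.

Definition on2 (g : letter -> letter -> tensor) (w : seq letter) : tensor :=
  if w is [:: a; b] then g a b else [::].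

(** The computable counterpart of [at_pos]. *)
Fixpoint row_at (row : letter -> letter -> tensor) (k : nat) (w : seq letter) : tensor :=
  match k, w with
  | 0, [:: a, b & w'] => [seq (x.1 ++ w', x.2) | x <- row a b]
  | k'.+1, a :: w' => [seq (a :: x.1, x.2) | x <- row_at row k' w']
  | _, _ => [::]
  end.

Definition braid_at := row_at row_braid.

Definition braids (ks : seq nat) (T : tensor) : tensor :=
  foldl (fun S k => tbind (braid_at k) S) T ks.

Definition letters := [:: v1; v2; v3; v0; vm3; vm2; vm1].

Section Tables2.
Local Open Scope Z_scope.
Definition gamma_v1 : tensor :=
  [:: ([:: v1; v0], lmono 0); ([:: v2; v3], [:: (-3, -1); (-1, -1)]);
      ([:: v3; v2], [:: (-6, 1); (-4, 1)]); ([:: v0; v1], [:: (-6, -1)])].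

(* (B - q^2) (B - q^-12), whose image is wedge2 *)
Definition row_wedge (a b : letter) : tensor :=
  tadd (tbind (braid_at 0) (row_braid a b))
    (tadd (tscale [:: (-12, -1); (2, -1)] (row_braid a b))
       [:: ([:: a; b], lmono (-10))]).
End Tables2.

Definition act2 (g : Uq_gen) : tensor -> tensor := tbind (on2 (row_rho2 g)).
Definition topp := tscale (lopp (lmono Z0)).

(** [F1] and [F2] generate V from v_1 along the path v_1, v_2, v_3, v_0, v_{-3}, v_{-2}, v_{-1}, so
    equivariance propagates the value at v_1. [topp] undoes the sign of the last three steps of the
    path. *)
Definition tab_gamma : seq tensor :=
  let g1 := gamma_v1 in
  let g2 := act2 F1 g1 in
  let g3 := act2 F2 g2 in
  let g0 := act2 F1 g3 in
  let gm3 := topp (act2 F1 g0) in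
  let gm2 := topp (act2 F2 gm3) in
  let gm1 := topp (act2 F1 gm2) in
  [:: g1; g2; g3; g0; gm3; gm2; gm1].
Definition row_gamma (a : letter) : tensor := nth [::] tab_gamma a.
Definition tab_psi : tensor :=
  tbind (fun w => if w is [:: r; c] then [seq (r :: x.1, x.2) | x <- row_gamma c] else [::])
    (tscale [:: (Zpos 3, Zneg 1)] tab_phi).
Definition psiphi := tprod tab_psi tab_phi.
Definition phipsi := tprod tab_phi tab_psi.

Lemma lettersP (a : letter) : a \in letters.
Proof. by case: a => -[|[|[|[|[|[|[|m]]]]]]] lt_m. Qed.

Lemma all_letters (P : letter -> bool) : all P letters -> forall a, P a.
Proof. by move=> /allP h a; apply: h; exact: lettersP. Qed.

Definition sized (n : nat) (T : tensor) : bool := all (fun x => size x.1 == n) T.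

(** The first two tests are the Yang-Baxter equation, in the two orientations that [braid_natural]
    asks for. The last two say that C, a polynomial in B, passes across a strand from either
    side. *)
Lemma natural_check :
  all (fun a => all (fun b => all (fun c =>
    let e : tensor := [:: ([:: a; b; c], lmono Z0)] in
    let t row k := tbind (row_at row k) in
    let B := row_braid in let C := row_wedge in
    [&& teq (t B 1 (t B 0 (t B 1 e))) (t B 0 (t B 1 (t B 0 e))),
        teq (t B 0 (t B 1 (t B 0 e))) (t B 1 (t B 0 (t B 1 e))),
        teq (t B 1 (t B 0 (t C 1 e))) (t C 0 (t B 1 (t B 0 e))) &
        teq (t B 0 (t B 1 (t C 0 e))) (t C 1 (t B 0 (t B 1 e)))])%N
  letters) letters) letters.
Proof. by vm_compute. Qed.

Lemma sized_check :
  all (fun a => all (fun b => sized 2 (row_braid a b) && sized 2 (row_wedge a b))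
    letters) letters.
Proof. by vm_compute. Qed.

(** * Products of generators *)

Section Rows.
Variables (K : fieldType) (q : K).
Hypothesis q0 : q != 0.

Definition word2 (M : lmodType K) (F : letter -> letter -> M) (w : seq letter) : M :=
  if w is [:: c; e] then F c e else 0.

Definition word3 (M : lmodType K) (F : letter -> letter -> letter -> M)
    (w : seq letter) : M :=
  if w is [:: a; b; c] then F a b c else 0.

Definition row_malg (row : letter -> letter -> tensor) (a b : letter) :
    {malg K[(letter * letter)%type]} :=
  teval q (word2 (fun c e => << (c, e) >>)) (row a b).

Variable row : letter -> letter -> tensor.
Hypothesis row2 : forall a b, sized 2 (row a b).

Lemma bind_row a b (M : lmodType K) (F : letter -> letter -> M) :
  bindp (row_malg row a b) F = teval q (word2 F) (row a b).
Proof.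
rewrite [LHS](lin_teval q); apply: eq_teval => -[|c [|e [|g w]]] /=;
  by rewrite ?linear0 // [LHS]linU.
Qed.

Lemma teval_word2 (M : lmodType K) (F : seq letter -> M) T : sized 2 T ->
  teval q F T = teval q (word2 (fun c e => F [:: c; e])) T.
Proof.
elim: T => [|[[|c [|e [|g w]]] p] T IH] //= sT; first by rewrite !teval_nil.
by rewrite !teval_cons IH.
Qed.

Lemma teval_row_at0 (M : lmodType K) (F : seq letter -> M) a b w :
  teval q F (row_at row 0 [:: a, b & w]) =
  bind (c, e) <- row_malg row a b; F [:: c, e & w].
Proof.
rewrite bind_row -[RHS](teval_word2 (fun x => F (x ++ w))) //.
by rewrite /teval big_map.
Qed.

Lemma teval_row_atS (M : lmodType K) (F : seq letter -> M) k a w :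
  teval q F (row_at row k.+1 (a :: w)) = teval q (fun w' => F (a :: w')) (row_at row k w).
Proof. by rewrite /teval big_map. Qed.
End Rows.

Section Natural.
Variables (K : fieldType) (q : K).
Hypothesis q0 : q != 0.
Variable D : VV_decomposition q.
Hypothesis braidE : forall a b, braid_letters D a b = row_malg q row_braid a b.
Let row_braid2 a b : sized 2 (row_braid a b).
Proof. by have /andP[] := all_letters (all_letters sized_check a) b. Qed.
Let row_wedge2 a b : sized 2 (row_wedge a b).
Proof. by have /andP[] := all_letters (all_letters sized_check a) b. Qed.

Lemma teval_one (M : lmodType K) (F : seq letter -> M) w :
  teval q F [:: (w, lmono Z0)] = F w.
Proof.
by rewrite /teval big_seq1 /leval big_seq1 /= expr0z mulr1 scale1r.
Qed.

(** [word3 F] turns any continuation into a function on words, so one equality of explicit tensors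
    yields the identity for all [M] and [F]. *)
Lemma row_natural row : (forall a b, sized 2 (row a b)) ->
  (forall a b c, let e : tensor := [:: ([:: a; b; c], lmono Z0)] in
    let t row k := tbind (row_at row k) in
    teq (t row_braid 1%N (t row_braid 0%N (t row 1%N e)))
      (t row 0%N (t row_braid 1%N (t row_braid 0%N e))) &&
    teq (t row_braid 0%N (t row_braid 1%N (t row 0%N e)))
      (t row 1%N (t row_braid 0%N (t row_braid 1%N e)))) ->
  braid_natural D (row_malg q row).
Proof.
move=> row2 chk M F a b c; have /andP[ck1 ck2] := chk a b c.
have w3 (r1 r2 r3 : letter -> letter -> tensor) k1 k2 k3 :
  teval q (word3 F) (tbind (row_at r3 k3) (tbind (row_at r2 k2) (tbind (row_at r1 k1)
    [:: ([:: a; b; c], lmono Z0)]))) =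
  teval q (fun x => teval q (fun y => teval q (word3 F) (row_at r3 k3 y)) (row_at r2 k2 x))
    (row_at r1 k1 [:: a; b; c]).
  by rewrite !(teval_bind q0) teval_one.
have := teval_teq q0 (word3 F) ck1; have := teval_teq q0 (word3 F) ck2.
rewrite !w3 => e2 e1.
have b0 r (r2 : forall a b, sized 2 (r a b)) (G : seq letter -> M) x y w :=
  @teval_row_at0 _ q r r2 _ G x y w.
have b1 r (r2 : forall a b, sized 2 (r a b)) (G : seq letter -> M) x y z w :
  teval q G (row_at r 1 [:: x, y, z & w]) =
  bind (y', z') <- row_malg q r y z; G [:: x, y', z' & w].
  by rewrite teval_row_atS b0.
split.
- transitivity (teval q (fun x => teval q (fun y => teval q (word3 F) (row_at row_braid 1 y))
    (row_at row_braid 0 x)) (row_at row 1 [:: a; b; c])); [|rewrite e1].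
    rewrite b1 //; apply: eq_bindp => b' c'; rewrite braidE b0 //.
    apply: eq_bindp => b2 a'; rewrite braidE b1 //; exact: eq_bindp.
  rewrite b0 // braidE; apply: eq_bindp => b' a'; rewrite braidE b1 //.
  apply: eq_bindp => c' a2; rewrite b0 //; exact: eq_bindp.
- transitivity (teval q (fun x => teval q (fun y => teval q (word3 F) (row_at row_braid 0 y))
    (row_at row_braid 1 x)) (row_at row 0 [:: a; b; c])); [|rewrite e2].
    rewrite b0 //; apply: eq_bindp => a' b'; rewrite braidE b1 //.
    apply: eq_bindp => c' b2; rewrite braidE b0 //; exact: eq_bindp.
  rewrite b1 // braidE; apply: eq_bindp => c' b'; rewrite braidE b0 //.
  apply: eq_bindp => c2 a'; rewrite b1 //; exact: eq_bindp.
Qed.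

Lemma braid_letters_natural : braid_natural D (braid_letters D).
Proof.
have -> : braid_letters D = row_malg q row_braid.
  by apply/funext => a; apply/funext => b; exact: braidE.
apply: row_natural => // a b c.
have /and4P[c1 c2 _ _] := all_letters (all_letters (all_letters natural_check a) b) c.
by apply/andP; split.
Qed.

Lemma wedge_natural : braid_natural D (row_malg q row_wedge).
Proof.
apply: row_natural => // a b c.
have /and4P[_ _ c2 c3] := all_letters (all_letters (all_letters natural_check a) b) c.
by apply/andP; split.
Qed.
End Natural.

Lemma teval_lin_exch (K : fieldType) (q : K) (G : choiceType) (M : lmodType K)
    (F : seq letter -> G -> M) T x :
  lin (fun u => teval q (F^~ u) T) x = teval q (fun w => lin (F w) x) T.
Proof.
rewrite /teval; elim: T => [|y T IH].
  rewrite big_nil -[RHS](lin0 _ x); apply: eq_lin => u; exact: big_nil.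
rewrite big_cons -IH /lin scaler_sumr -big_split; apply: eq_bigr => g _ /=.
by rewrite big_cons scalerDr !scalerA mulrC.
Qed.

(** * Ordering products of generators by braids *)

Section Chain.
Variables (K : fieldType) (q : K) (D : VV_decomposition q).
Local Notation BL := (braid_letters D).
Local Notation bml := (braid_mword_letter D).
Hypothesis BL_nat : braid_natural D BL.

(* Right multiplication by X_{pa}. *)
Fixpoint rmul (m p : nat) (a : letter) : mword m -> {malg K[mword m]} :=
  match m, p return mword m -> {malg K[mword m]} with
  | 0, _ => fun=> 0
  | n.+1, 0 => fun us => bind (a', us') <- bml us.2 a;
      << mcons (mmul us.1 (FMonom [:: a'])) us' >>
  | n.+1, k.+1 => fun us => bind us' <- rmul k a us.2; << mcons us.1 us' >>
  end.

Section M.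
Variable M : lmodType K.

Lemma rmul0 n a u us (F : mword n.+1 -> M) :
  lin F (rmul 0 a (mcons (FMonom u) us)) =
  bind (a', us') <- bml us a; F (mcons (FMonom (u ++ [:: a'])) us').
Proof.
by rewrite [LHS]lin_bindp; apply: eq_bindp => a' us'; rewrite [LHS]linU mmul_word.
Qed.

Lemma rmulS n k a u us (F : mword n.+1 -> M) :
  lin F (rmul k.+1 a (mcons u us)) = bind us' <- rmul k a us; F (mcons u us').
Proof. by rewrite [LHS]lin_lin; apply: eq_lin => us'; rewrite [LHS]linU. Qed.

(** When a letter [a] crosses [us] multiplied by X_{kb}, it may be braided with [b] at once. For k =
    0 the letter [b] has already moved left through the later factors, and naturality lets the two
    letters be braided before that move instead of after it. *)
Lemma braid_mword_letter_rmul n k b a us (F : letter -> mword n -> M) :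
  (bind us' <- rmul k b us; bindp (bml us' a) F) =
  bind (c, e) <- BL b a; bind (c1, us1) <- bml us c;
  bind us2 <- rmul k e us1; F c1 us2.
Proof.
elim: n k b a us F => [|n IH] k b a us F.
  rewrite [LHS]linear0; apply/esym.
  apply: etrans (eq_bindp _ _) (bindp0 _ _) => c e; rewrite [LHS]bindpU.
  by rewrite [LHS]linear0.
have [u [us' ->]] := mconsP us; move: us' => {}us.
case: k => [|k].
  rewrite [LHS]rmul0.
  apply: (@etrans _ _ (bind (b', us1) <- bml us b; bind (a', us2) <- bml us1 a;
    bind (c, e) <- BL b' a'; bind (c', u') <- braid_seq_letter D u c;
    F c' (mcons (FMonom (u' ++ [:: e])) us2))).
    apply: eq_bindp => b' us1; rewrite [LHS]braid_mword_letterS; apply: eq_bindp => a' us2.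
    rewrite [LHS]braid_seq_letter_cat [LHS]braid_seq_letter_cons [LHS]bindpU; apply: eq_bindp => c e.
    by [].
  rewrite -[LHS](braid_mword_letter_natural BL_nat us b a (fun c e us2 =>
    bind (c', u') <- braid_seq_letter D u c;
    F c' (mcons (FMonom (u' ++ [:: e])) us2))).
  apply: eq_bindp => c e; rewrite [RHS]braid_mword_letterS; apply: eq_bindp => c1 us1.
  rewrite [LHS]bindp_exch; apply: eq_bindp => c2 u'; by rewrite [RHS]rmul0.
rewrite [LHS]rmulS.
apply: etrans (eq_lin _ _) _ => [us'|]; first by rewrite [LHS]braid_mword_letterS.
rewrite [LHS]IH; apply: eq_bindp => c e; rewrite [RHS]braid_mword_letterS.
apply: eq_bindp => c1 us1; rewrite [LHS]lin_bindp_exch.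
by apply: eq_bindp => c2 u'; rewrite [RHS]rmulS.
Qed.

(** The defining exchange relation of the braided product, stated for right multiplications of an
    arbitrary basis element so that it can be used in the middle of a product without
    associativity. *)
Lemma rmul_swap n p p' b a u (F : mword n -> M) : (p < p')%N ->
  (bind u' <- rmul p' b u; lin F (rmul p a u')) =
  bind (c, e) <- BL b a; bind u' <- rmul p c u; lin F (rmul p' e u').
Proof.
elim: n p p' b a u F => [|n IH] p p' b a us F lt_p.
  rewrite [LHS]linear0; apply/esym.
  by apply: etrans (eq_bindp _ _) (bindp0 _ _) => c e; rewrite [LHS]linear0.
have [u [us' ->]] := mconsP us; move: us' => {}us.
case: p' lt_p => // k; case: p => [|p] lt_p; rewrite [LHS]rmulS.
  apply: etrans (eq_lin _ _) _ => [us'|]; first by rewrite [LHS]rmul0.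
  rewrite [LHS]braid_mword_letter_rmul; apply: eq_bindp => c e; rewrite [RHS]rmul0.
  by apply: eq_bindp => c1 us1; rewrite [RHS]rmulS.
apply: etrans (eq_lin _ _) _ => [us'|]; first by rewrite [LHS]rmulS.
rewrite [LHS](IH p k b a us (fun us' => F (mcons (FMonom u) us'))) //.
apply: eq_bindp => c e; rewrite [RHS]rmulS; apply: eq_lin => us'.
by rewrite [RHS]rmulS.
Qed.
End M.

Fixpoint lcons (m p : nat) (a : letter) : mword m -> mword m :=
  match m, p return mword m -> mword m with
  | 0, _ => id
  | n.+1, 0 => fun us => mcons (mmul (FMonom [:: a]) us.1) us.2
  | n.+1, k.+1 => fun us => mcons us.1 (lcons k a us.2)
  end.

(* The letters of a word in low p sit at positions >= p, so that left
   multiplication by X_{pa} involves no braiding and is lcons p a. *)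
Fixpoint low (m p : nat) : mword m -> bool :=
  match m, p return mword m -> bool with
  | n.+1, k.+1 => fun us => (us.1 == mone) && low k us.2
  | _, _ => xpredT
  end.

Lemma lcons0 n a w ws : @lcons n.+1 0 a (mcons (FMonom w) ws) = mcons (FMonom (a :: w)) ws.
Proof. by rewrite /lcons /= mmul_word. Qed.

Lemma lconsS n p a w (ws : mword n) : lcons p.+1 a (mcons w ws) = mcons w (lcons p a ws).
Proof. by []. Qed.

Lemma low_one m p : low p (mword_one m).
Proof. by elim: m p => [|m IH] [|p] //=; rewrite eqxx IH. Qed.

Lemma low_lcons m p p' a (w : mword m) : (p <= p')%N -> low p w -> low p (lcons p' a w).
Proof.
elim: m p p' w => [|m IH] [|p] [|p'] w //= le_p /andP[-> lw] /=.
exact: IH.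
Qed.

Lemma mword_X_lcons m p a : mword_X m p a = lcons p a (mword_one m).
Proof.
elim: m p => [|m IH] [|p] //=; last by rewrite IH.
by rewrite mone_word mmul_word.
Qed.

Section M2.
Variable M : lmodType K.

Lemma mword_mul_one m u (F : mword m -> M) : lin F (mword_mul D u (mword_one m)) = F u.
Proof.
elim: m u F => [|m IH] us F; first by rewrite [LHS]linU; case: us.
have [u [us' ->]] := mconsP us; move: us' => {}us.
rewrite [LHS](bind_mword_mulS D (FMonom u) us mone (mword_one m)) mone_word [LHS]braid_mword_nil_r [LHS]IH.
by rewrite mmul_word cats0.
Qed.

(** The fragment of associativity that is needed: u (X_{pa} w) = (u X_{pa}) w when [w] starts no
    earlier than p. The factors of [w] before p are empty, so no braiding occurs there. *)
Lemma mword_mul_lcons m p a u w (F : mword m -> M) : (p < m)%N -> low p w ->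
  lin F (mword_mul D u (lcons p a w)) =
  bind u' <- rmul p a u; lin F (mword_mul D u' w).
Proof.
elim: m p u w F => // m IH p us ws F lt_p.
have [u [us' ->]] := mconsP us; move: us' => {}us.
have [w [ws' ->]] := mconsP ws; move: ws' => {}ws.
case: p lt_p => [_ _|p lt_p /= /andP[/eqP w1 lw]].
  rewrite lcons0 [LHS]bind_mword_mulS [LHS]braid_mword_cons_r [RHS]rmul0.
  apply: eq_bindp => a' us'; rewrite [RHS]bind_mword_mulS; apply: eq_bindp => w' us2.
  by apply: eq_lin => vs; rewrite !mmul_word -catA.
rewrite w1 [LHS](bind_mword_mulS D (FMonom u) us mone (lcons p a ws)) mone_word [LHS]braid_mword_nil_r.
rewrite [LHS]IH // [RHS]rmulS; apply: eq_lin => us'.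
by rewrite [RHS]bind_mword_mulS [RHS]braid_mword_nil_r.
Qed.

Lemma braid_mword_letter_one m a (F : letter -> mword m -> M) :
  bindp (bml (mword_one m) a) F = F a (mword_one m).
Proof.
elim: m F => [|m IH] F; first by rewrite [LHS]bindpU.
rewrite -[mword_one m.+1]/(mcons mone (mword_one m)) mone_word.
by rewrite [LHS]braid_mword_letterS [LHS]IH [LHS]bindpU.
Qed.

Lemma rmul_one m p a (F : mword m -> M) : (p < m)%N ->
  lin F (rmul p a (mword_one m)) = F (lcons p a (mword_one m)).
Proof.
elim: m p F => // m IH [|p] F lt_p;
  rewrite -[mword_one m.+1]/(mcons mone (mword_one m)) mone_word.
  by rewrite [LHS]rmul0 [LHS]braid_mword_letter_one lcons0.
by rewrite [LHS]rmulS [LHS]IH.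
Qed.

(** The letter [b] only crosses factors after p', and [a] is prepended at or before p', so the two
    operations do not meet. *)
Lemma rmul_lcons m p p' b a w (F : mword m -> M) : (p <= p')%N ->
  lin F (rmul p' b (lcons p a w)) = bind w' <- rmul p' b w; F (lcons p a w').
Proof.
elim: m p p' w F => [|m IH] p p' ws F le_p.
  by rewrite [LHS]linear0 [RHS]linear0.
have [w [ws' ->]] := mconsP ws; move: ws' => {}ws.
case: p p' le_p => [|p] [|p'] le_p; last 1 first.
- rewrite lconsS [LHS]rmulS [RHS]rmulS.
  exact: (IH p p' ws (fun ws' => F (mcons (FMonom w) ws')) le_p).
- rewrite lcons0 [LHS]rmul0 [RHS]rmul0; apply: eq_bindp => b' ws'.
  by rewrite lcons0.
- by rewrite lcons0 [LHS]rmulS [RHS]rmulS; apply: eq_lin => ws'; rewrite lcons0.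
- discriminate le_p.
Qed.
End M2.

(** The left-normed product of [u] with the generators X_{pa}, for p in [ps] and a in [w]. *)
Fixpoint chain m (ps : seq nat) (w : seq letter) (u : mword m) : {malg K[mword m]} :=
  match ps, w with
  | p :: ps', a :: w' => bind u' <- rmul p a u; chain ps' w' u'
  | [::], [::] => << u >>
  | _, _ => 0
  end.

Lemma chain_cat m ps ps' w w' (u : mword m) : size ps = size w ->
  chain (ps ++ ps') (w ++ w') u = bind u' <- chain ps w u; chain ps' w' u'.
Proof.
elim: ps w u => [|p ps IH] [|a w] u //=; first by move=> _; rewrite [RHS]linU.
move=> [sz]; rewrite [RHS]lin_lin; apply: eq_lin => u'; exact: IH.
Qed.

Fixpoint swap_at (k : nat) (ps : seq nat) : seq nat :=
  match k, ps with
  | 0, [:: p', p & r] => [:: p, p' & r]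
  | k'.+1, p :: r => p :: swap_at k' r
  | _, _ => ps
  end.

(** Strict, since letters at equal positions lie in the same copy of T(V) and are not braided. *)
Fixpoint descent (k : nat) (ps : seq nat) : bool :=
  match k, ps with
  | 0, [:: p', p & r] => (p < p')%N
  | k'.+1, p :: r => descent k' r
  | _, _ => false
  end.

Fixpoint descents (ks : seq nat) (ps : seq nat) : bool :=
  if ks is k :: ks' then descent k ps && descents ks' (swap_at k ps) else true.

Definition swaps (ks : seq nat) (ps : seq nat) := foldl (fun ps k => swap_at k ps) ps ks.

Hypothesis q0 : q != 0.
Hypothesis braidE : forall a b, braid_letters D a b = row_malg q row_braid a b.
Hypothesis row_braid2 : forall a b, sized 2 (row_braid a b).

Lemma chain_braid_at m k ps w (u : mword m) : descent k ps ->
  chain ps w u = teval q (fun w' => chain (swap_at k ps) w' u) (braid_at k w).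
Proof.
elim: k ps w u => [|k IH] [|p ps] w u des; try by [].
  case: ps des => [|p2 ps] des; first by [].
  case: w => [|a [|b w]]; first by rewrite teval_nil.
    by rewrite teval_nil; apply: lin0.
  rewrite [RHS]teval_row_at0 // -braidE.
  exact: (rmul_swap a b u (fun u' => chain ps w u') des).
case: w => [|a w]; first by rewrite teval_nil.
rewrite [RHS]teval_row_atS -[RHS]teval_lin_exch; apply: eq_lin => u'.
exact: IH.
Qed.

Lemma chain_braids m ks ps T (u : mword m) : descents ks ps ->
  teval q (fun w => chain ps w u) T =
  teval q (fun w => chain (swaps ks ps) w u) (braids ks T).
Proof.
elim: ks ps T => [|k ks IH] ps T //= /andP[des dess].
rewrite -[RHS](IH (swap_at k ps)) // [RHS](teval_bind q0).
by apply: eq_teval => w; apply: chain_braid_at.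
Qed.
End Chain.

(** * The matrix of the braiding *)

Lemma letter_ind7 (P : letter -> Prop) :
  P v1 -> P v2 -> P v3 -> P v0 -> P vm3 -> P vm2 -> P vm1 -> forall a, P a.
Proof.
move=> P1 P2 P3 P0 P4 P5 P6 a; have := lettersP a.
rewrite !inE; by do ![case/orP; first by move=> /eqP->]; move/eqP->.
Qed.

Section Vectors.
Variables (K : fieldType) (q : K).
Hypothesis q0 : q != 0.
Local Notation vv := (@vv K).

Definition vsum (M : lmodType K) (g : letter -> letter -> M) (u : 'rV[K]_(7 * 7)) : M :=
  \sum_a \sum_b u 0 (mxtens_index (a, b)) *: g a b.

Lemma vsum_is_linear (M : lmodType K) (g : letter -> letter -> M) : linear (vsum g).
Proof.
move=> c u v; rewrite /vsum scaler_sumr -big_split; apply: eq_bigr => a _ /=.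
rewrite scaler_sumr -big_split; apply: eq_bigr => b _ /=.
by rewrite !mxE scalerDl scalerA.
Qed.

HB.instance Definition _ (M : lmodType K) (g : letter -> letter -> M) :=
  GRing.isLinear.Build K 'rV[K]_(7 * 7) M *:%R (vsum g) (vsum_is_linear g).

Lemma vsum_vv (M : lmodType K) (g : letter -> letter -> M) a b : vsum g (vv a b) = g a b.
Proof.
rewrite /vsum (bigD1 a) //= (bigD1 b) //= !mxE !eqxx scale1r.
rewrite !big1 ?addr0 // => [c ca|c cb]; last first.
  by rewrite mxE (inj_eq (can_inj (@mxtens_indexK 7 7))) xpair_eqE (negPf cb) !andbF scale0r.
apply: big1 => e _.
by rewrite mxE (inj_eq (can_inj (@mxtens_indexK 7 7))) xpair_eqE (negPf ca) andbF scale0r.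
Qed.

Lemma vsum_id u : vsum vv u = u.
Proof.
apply/rowP => k; case: (mxtens_indexP k) => a b.
have := vsum_vv (fun c e => (u 0 (mxtens_index (c, e)) : K^o)) a b.
rewrite /vsum summxE => <-; apply: eq_bigr => c _; rewrite summxE.
apply: eq_bigr => e _; rewrite !mxE eq_sym; rewrite [_ *: _]mulrC.
by [].
Qed.

Lemma vsum_teval (M : lmodType K) (g : letter -> letter -> M) T :
  vsum g (teval q (word2 vv) T) = teval q (word2 g) T.
Proof.
rewrite (teval_linear q _ _ (vsum_is_linear g)); apply: eq_teval => -[|a [|b [|c w]]] /=;
  by rewrite ?linear0 ?vsum_vv.
Qed.

Lemma eq_mx_vv n (A B : 'M[K]_(7 * 7, n)) :
  (forall a b, vv a b *m A = vv a b *m B) -> A = B.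
Proof.
move=> E; apply/row_matrixP => k; case: (mxtens_indexP k) => a b.
by rewrite !rowE; exact: E.
Qed.

Definition row_mx_of (row : letter -> letter -> tensor) : 'M[K]_(7 * 7) :=
  \matrix_(i, j) teval q (word2 vv) (row (mxtens_unindex i).1 (mxtens_unindex i).2) 0 j.

Lemma vv_row_mx_of row a b : vv a b *m row_mx_of row = teval q (word2 vv) (row a b).
Proof. by rewrite -rowE; apply/rowP => j; rewrite !mxE mxtens_indexK. Qed.

Lemma teval_row_mx_of row T :
  teval q (word2 vv) T *m row_mx_of row = teval q (word2 vv) (tbind (on2 row) T).
Proof.
rewrite (teval_bind q0) -[LHS]/(mulmxr (row_mx_of row) _) (teval_linear q _ _ (linearP _)).
apply: eq_teval => -[|a [|b [|c w]]] /=; rewrite ?mul0mx ?teval_nil //.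
exact: vv_row_mx_of.
Qed.

Definition word1 (w : seq letter) : 'rV[K]_7 := if w is [:: a] then delta_mx 0 a else 0.

Definition vtens (u v : 'rV[K]_7) : 'rV[K]_(7 * 7) :=
  \row_k (u 0 (mxtens_unindex k).1 * v 0 (mxtens_unindex k).2).

Lemma vv_tens a b (A B : 'M[K]_7) :
  vv a b *m (A *t B) = vtens (delta_mx 0 a *m A) (delta_mx 0 b *m B).
Proof.
rewrite -!rowE; apply/rowP => k; case: (mxtens_indexP k) => c e.
by rewrite !mxE !mxtens_indexK.
Qed.

Lemma vtens_linl v : linear (vtens ^~ v).
Proof. by move=> c u w; apply/rowP => k; rewrite !mxE mulrDl mulrA. Qed.

Lemma vtens_linr u : linear (vtens u).
Proof. by move=> c v w; apply/rowP => k; rewrite !mxE mulrDr mulrCA. Qed.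

Lemma vtens_delta a b : vtens (delta_mx 0 a) (delta_mx 0 b) = vv a b.
Proof.
apply/rowP => k; case: (mxtens_indexP k) => c e.
rewrite !mxE mxtens_indexK (inj_eq (can_inj (@mxtens_indexK 7 7))) xpair_eqE /=.
by case: (c == a); case: (e == b); rewrite ?mulr1 ?mulr0 ?mul0r.
Qed.

Lemma teval_prod T S : sized 1 T -> sized 1 S ->
  teval q (word2 vv) (tprod T S) = vtens (teval q word1 T) (teval q word1 S).
Proof.
move=> sT sS; rewrite (teval_linear q _ _ (vtens_linl _)).
rewrite /teval /tprod; rewrite big_allpairs_dep /=.
elim: T sT => [|[w p] T IH]; first by rewrite !big_nil.
rewrite !big_cons => /andP[/= /eqP sw sT]; rewrite IH //; congr (_ + _).
case: w sw => [|a [|b w]] // _; rewrite (teval_linear q _ _ (vtens_linr _)) /teval scaler_sumr.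
elim: S sS {IH} => [|[w r] S IH]; first by rewrite !big_nil.
rewrite !big_cons => /andP[/= /eqP sw sS]; rewrite IH //; congr (_ + _).
case: w sw => [|b [|c w]] // _ /=; by rewrite (leval_mul q0) scalerA vtens_delta.
Qed.

Lemma leval_mono e : leval q (lmono e) = q ^ int_of_Z e.
Proof. by rewrite /leval big_seq1 mul1r. Qed.

Lemma row_rhoE g a : delta_mx 0 a *m rhoV q g = teval q word1 (row_rho g a).
Proof.
have diagE (s : seq int) :
    delta_mx 0 a *m q_diag q s = q ^ s`_a *: delta_mx 0 a :> 'rV[K]_7.
  by rewrite -rowE row_diag_mx mxE.
have la_E : leval q lbracket2 = q + q^-1.
  by rewrite /leval /lbracket2 !big_cons big_nil /= !mul1r addr0 addrC expr1z.
have laN : leval q (lopp lbracket2) = - (q + q^-1).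
  by rewrite -la_E /leval /lbracket2 !big_cons big_nil /= !mulN1r !mul1r !addr0 opprD.
have l1 : leval q (lmono Z0) = 1 by rewrite leval_mono expr0z.
have lN1 : leval q (lopp (lmono Z0)) = -1 by rewrite /leval big_seq1 /= expr0z mulr1.
case: g; elim/letter_ind7: a diagE => diagE; rewrite /rhoV ?diagE /row_rho /=
  ?teval_nil ?teval_cons ?teval_nil ?addr0 ?leval_mono /=
  ?mulmxBr ?mulmxDr -?scalemxAr ?mul_delta_mx_cond /= ?mulr0n ?mulr1n
  ?scaler0 ?subr0 ?addr0 ?add0r ?sub0r ?l1 ?lN1 ?la_E ?laN ?scale1r ?scaleN1r ?scaleNr //.
Qed.
End Vectors.

(** * Certificates for the eigenvalues *)

Section Certificates.
Local Open Scope Z_scope.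
(** On a weight space, a map that vanishes on the common kernel of [E1] and [E2] factors through the
    pair (E1, E2). These tables are the two components of such a factorisation of B - c, multiplied
    by [2]_q so that their entries are Laurent polynomials. *)
Definition cert_l2_E1 : seq (seq letter * tensor) :=
  [:: ([:: v1; v1], [:: ([:: v1; v2], [:: (-1, 1); (1, 1)]);
       ([:: v2; v1], [:: (0, 1); (2, 1)])])].
Definition cert_l2_E2 : seq (seq letter * tensor) := [::].
Definition cert_l1_E1 : seq (seq letter * tensor) :=
  [:: ([:: v1; v3], [:: ([:: v1; v0], [:: (-6, 1)]);
       ([:: v0; v1], [:: (0, 1)])]);
    ([:: v3; v1], [:: ([:: v1; v0], [:: (-1, 1)]);
       ([:: v2; v3], [:: (-4, -1); (0, 1)]);
       ([:: v3; v2], [:: (-7, 1); (-3, -1)]);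
       ([:: v0; v1], [:: (-5, 1); (-1, -1); (1, 1)])])].
Definition cert_l1_E2 : seq (seq letter * tensor) :=
  [:: ([:: v2; v2], [:: ([:: v1; v0], [:: (-4, -1)]);
       ([:: v2; v3], [:: (-7, 1); (-5, 1)]);
       ([:: v3; v2], [:: (-2, 1); (0, 1)]);
       ([:: v0; v1], [:: (-2, -1)])])].
Definition cert_0_E1 : seq (seq letter * tensor) :=
  [:: ([:: v1; vm2], [:: ([:: v1; vm1], [:: (-13, 1); (-11, 1)]);
       ([:: vm1; v1], [:: (-3, -1); (-1, -1)])]);
    ([:: v3; v0], [:: ([:: v1; vm1], [:: (-8, 1)]);
       ([:: v2; vm2], [:: (-9, 1)]);
       ([:: v3; vm3], [:: (-12, 1)]);
       ([:: vm3; v3], [:: (-2, -1)]);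
       ([:: vm2; v2], [:: (-5, -1)]);
       ([:: vm1; v1], [:: (-6, -1); (-4, 1); (0, -1)])]);
    ([:: v0; v3], [:: ([:: v1; vm1], [:: (-8, -1)]);
       ([:: v2; vm2], [:: (-9, -1)]);
       ([:: v3; vm3], [:: (-12, -1)]);
       ([:: v0; v0], [:: (-12, -1); (0, 1)]);
       ([:: vm3; v3], [:: (-4, 1); (-2, 1); (0, -1)]);
       ([:: vm2; v2], [:: (-7, 1); (-5, 1); (-3, -1)]);
       ([:: vm1; v1], [:: (-8, 1); (-4, -1); (-2, 1)])]);
    ([:: vm2; v1], [:: ([:: v1; vm1], [:: (-4, -1); (-2, -1)]);
       ([:: v2; vm2], [:: (-5, -1); (-1, 1)]);
       ([:: v3; vm3], [:: (-8, -1); (-4, 1)]);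
       ([:: v0; v0], [:: (-8, -1); (-4, 1); (-2, -1); (2, 1)]);
       ([:: vm3; v3], [:: (-10, -1); (-4, -1); (-2, 1); (0, 1)]);
       ([:: vm2; v2], [:: (-13, -1); (-7, -1); (-5, 1); (-3, 1)]);
       ([:: vm1; v1], [:: (-12, 1); (-6, 2); (2, -1)])])].
Definition cert_0_E2 : seq (seq letter * tensor) :=
  [:: ([:: v2; vm3], [:: ([:: v1; vm1], [:: (-12, 1); (-10, 1)]);
       ([:: v2; vm2], [:: (-13, 1); (-11, 1)]);
       ([:: vm2; v2], [:: (-3, -1); (-1, -1)]);
       ([:: vm1; v1], [:: (-4, -1); (-2, -1)])]);
    ([:: vm3; v2], [:: ([:: v1; vm1], [:: (-7, -1); (-5, -1)]);
       ([:: v2; vm2], [:: (-8, -1); (-6, -1)]);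
       ([:: v3; vm3], [:: (-11, -1); (-9, -1); (-3, 1); (-1, 1)]);
       ([:: v0; v0], [:: (-11, -1); (-9, -1); (-3, 1); (-1, 1)]);
       ([:: vm3; v3], [:: (-13, -1); (-11, -1); (-5, 1); (-3, 1)]);
       ([:: vm2; v2], [:: (-8, 1); (-6, 1); (-4, 1); (0, -1)]);
       ([:: vm1; v1], [:: (-9, 1); (-7, 1); (-5, 1); (-1, -1)])])].
End Certificates.

Fixpoint cert_row (tab : seq (seq letter * tensor)) (a b : letter) : tensor :=
  if tab is (w, T) :: tab' then
    if word_compare w [:: a; b] is Eq then T else cert_row tab' a b
  else [::].

Definition weight1 (a : letter) : int := nth 0 [:: 1; -1; 2; 0; -2; 1; -1] a.
Definition weight2 (a : letter) : int := nth 0 [:: 0; 3; -3; 0; 3; -3; 0] a.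

(* Checks that [2]_q (B - c) = E1 Z1 + E2 Z2 on the weight space of
   x alpha_1 + y alpha_2, so that B acts by c on a vector of this weight
   killed by E1 and E2. *)
Definition hw_check (x y : int) (c : laurent) (Z1 Z2 : seq (seq letter * tensor)) : bool :=
  all (fun a => all (fun b =>
    ((weight1 a + weight1 b == 2 * x - 3 * y) &&
     (weight2 a + weight2 b == 6 * y - 3 * x)) ==>
    teq (tscale lbracket2 (tadd (row_braid a b) [:: ([:: a; b], lopp c)]))
        (tadd (tbind (on2 (cert_row Z1)) (row_rho2 E1 a b))
              (tbind (on2 (cert_row Z2)) (row_rho2 E2 a b)))) letters) letters.

Definition eig_2l1 : laurent := lmono (Zpos 2).
Definition eig_l2 : laurent := lopp (lmono Z0).
Definition eig_l1 : laurent := lopp (lmono (Zneg 6)).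
Definition eig_0 : laurent := lmono (Zneg 12).

(** This weight space is the line of v_1 (x) v_1, on which B already acts by q^2, so empty
    certificates suffice. *)
Lemma hw_check_2l1 : hw_check 4 2 eig_2l1 [::] [::]. Proof. by vm_compute. Qed.
Lemma hw_check_l2 : hw_check 3 2 eig_l2 cert_l2_E1 cert_l2_E2. Proof. by vm_compute. Qed.
Lemma hw_check_l1 : hw_check 2 1 eig_l1 cert_l1_E1 cert_l1_E2. Proof. by vm_compute. Qed.
Lemma hw_check_0 : hw_check 0 0 eig_0 cert_0_E1 cert_0_E2. Proof. by vm_compute. Qed.

Definition gens := [:: E1; E2; F1; F2; K1; K2; K1V; K2V].

Lemma commute_check :
  all (fun g => all (fun a => all (fun b =>
    teq (tbind (on2 row_braid) (row_rho2 g a b))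
        (tbind (on2 (row_rho2 g)) (row_braid a b))) letters) letters) gens.
Proof. by vm_compute. Qed.

Lemma rho_sized : all (fun g => all (fun a => sized 1 (row_rho g a)) letters) gens.
Proof. by vm_compute. Qed.

Lemma all_gens (P : Uq_gen -> bool) : all P gens -> forall g, P g.
Proof. by move=> /and5P[? ? ? ? /and5P[? ? ? ? _]]; case. Qed.

(** * Eigenspaces of the braiding matrix *)

Section Rcheck.
Variables (K : fieldType) (q : K).
Hypothesis q0 : q != 0.
Hypothesis q_inf : forall n : int, q ^ n = 1 -> n = 0.
Local Notation vv := (@vv K).
Local Notation braid_mx := (row_mx_of q row_braid).
Local Notation wedge_mx := (row_mx_of q row_wedge).

Lemma vv_mulE n a b (A : 'M[K]_(7 * 7, n)) k :
  (vv a b *m A) 0 k = A (mxtens_index (a, b)) k.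
Proof. by rewrite -rowE mxE. Qed.

Lemma row_rho2E g a b :
  vv a b *m rhoVV q g = teval q (word2 vv) (row_rho2 g a b).
Proof.
have s1 g' a' : sized 1 (row_rho g' a') by apply: (all_letters (all_gens rho_sized g')).
have id1 a' : teval q (word1 K) (row_id a') = delta_mx 0 a' *m 1%:M by rewrite teval_one mulmx1.
by case: g; cbn [rhoVV row_rho2]; rewrite ?mulmxDr ?teval_add ?vv_tens ?(teval_prod q0) ?s1 // !row_rhoE ?id1.
Qed.

Lemma rhoVV_comm g : rhoVV q g *m braid_mx = braid_mx *m rhoVV q g.
Proof.
have rE : rhoVV q g = row_mx_of q (row_rho2 g).
  by apply: eq_mx_vv => a b; rewrite row_rho2E vv_row_mx_of.
apply: eq_mx_vv => a b; rewrite !mulmxA row_rho2E (teval_row_mx_of q0).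
rewrite rE vv_row_mx_of (teval_row_mx_of q0); apply: (teval_teq q0).
exact: (all_letters (all_letters (all_gens commute_check g) a) b).
Qed.

Lemma rhoVV_diag g (s : seq int) : rhoV q g = q_diag q s -> rhoVV q g = rhoV q g *t rhoV q g ->
  forall (u : 'rV[K]_(7 * 7)) a b, (u *m rhoVV q g) 0 (mxtens_index (a, b)) =
    q ^ (s`_a + s`_b) * u 0 (mxtens_index (a, b)).
Proof.
move=> gE ->; rewrite gE => u a b.
rewrite mxE (bigD1 (mxtens_index (a, b))) //= tensmxE !mxE !eqxx !mulr1n.
rewrite big1 ?addr0 => [|k]; first by rewrite expfzDr // mulrC.
case: (mxtens_indexP k) => c e; rewrite (inj_eq (can_inj (@mxtens_indexK 7 7))) xpair_eqE.
rewrite tensmxE !mxE; case: (c == a) => /=; last by rewrite mulr0n mul0r mulr0.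
by move/negPf ->; rewrite mulr0n mulr0 mulr0.
Qed.

Lemma q_inj (m n : int) : q ^ m = q ^ n -> m = n.
Proof.
move=> E; apply/eqP; rewrite -subr_eq0; apply/eqP/q_inf.
by rewrite expfzDr // -invr_expz E mulfV // expfz_neq0.
Qed.

(** If q^n = -1, then q^(2n) = 1. *)
Lemma qD1_neq0 (n : int) : n != 0 -> 1 + q ^ n != 0.
Proof.
move=> n0; apply/eqP => E; have qn : q ^ n = -1 by apply/eqP; rewrite -addr_eq0 addrC E.
have : n * 2 = 0 by apply: q_inf; rewrite -exprz_exp qn -[LHS]/((-1) ^+ 2) sqrrN expr1n.
by move/eqP; rewrite mulf_eq0 (negPf n0).
Qed.

Lemma hw_eigen x y c Z1 Z2 u : hw_check x y c Z1 Z2 -> VV_hw_vector q x y u ->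
  u *m braid_mx = leval q c *: u.
Proof.
move=> chk [_ uE1 uE2 uK1 uK2].
(* [u] is supported on its weight space: a nonzero coordinate forces equality of the [K1] and [K2]
   eigenvalues, hence of the exponents of q. *)
have wt a b : u 0 (mxtens_index (a, b)) != 0 ->
    (weight1 a + weight1 b == 2 * x - 3 * y) &&
    (weight2 a + weight2 b == 6 * y - 3 * x).
  move=> nz; apply/andP; split; apply/eqP; apply: q_inj.
    have := rhoVV_diag (erefl (rhoV q K1)) erefl u a b.
    by rewrite uK1 mxE => /(mulIf nz).
  have := rhoVV_diag (erefl (rhoV q K2)) erefl u a b.
  by rewrite uK2 mxE => /(mulIf nz).
have la_E : leval q lbracket2 != 0.
  have -> : leval q lbracket2 = q ^ (-1) * (1 + q ^ 2).
    rewrite /leval /lbracket2 !big_cons big_nil /= !mul1r addr0 mulrDr mulr1.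
    by rewrite -expfzDr.
  by rewrite mulf_neq0 ?expfz_neq0 // qD1_neq0.
have negE p : leval q (lopp p) = - leval q p.
  rewrite /leval /lopp big_map -sumrN; apply: eq_bigr => e _ /=.
  by rewrite -[Z.opp _]/(- e.2) rmorphN rmorphN mulNr.
(* The coordinate is kept as a factor because the certificate says nothing about pairs of another
   weight. *)
have key a b : u 0 (mxtens_index (a, b)) *: (leval q lbracket2 *: (vv a b *m braid_mx - leval q c *: vv a b)) =
   u 0 (mxtens_index (a, b)) *: (vv a b *m rhoVV q E1 *m row_mx_of q (cert_row Z1)
     + vv a b *m rhoVV q E2 *m row_mx_of q (cert_row Z2)).
  have [->|nz] := eqVneq (u 0 (mxtens_index (a, b))) 0; first by rewrite !scale0r.
  congr (_ *: _); rewrite !row_rho2E !(teval_row_mx_of q0) vv_row_mx_of.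
  have /implyP/(_ (wt a b nz)) := all_letters (all_letters chk a) b.
  move/(teval_teq q0 (word2 vv)); rewrite (teval_scale q0) !teval_add teval_cons teval_nil addr0.
  by rewrite negE scaleNr.
have sum_vv (X : 'M[K]_(7 * 7)) :
    u *m X = \sum_a \sum_b u 0 (mxtens_index (a, b)) *: (vv a b *m X).
  rewrite -{1}[u]vsum_id /vsum mulmx_suml; apply: eq_bigr => a _.
  by rewrite mulmx_suml; apply: eq_bigr => b _; rewrite scalemxAl.
have E0 : leval q lbracket2 *: (u *m (braid_mx - (leval q c)%:M)) = 0.
  transitivity (u *m (rhoVV q E1 *m row_mx_of q (cert_row Z1) + rhoVV q E2 *m row_mx_of q (cert_row Z2))).
    rewrite !sum_vv scaler_sumr; apply: eq_bigr => a _.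
    rewrite scaler_sumr; apply: eq_bigr => b _.
    rewrite scalerA mulrC -scalerA mulmxBr mul_mx_scalar key.
    by rewrite mulmxDr !mulmxA.
  by rewrite mulmxDr !mulmxA uE1 uE2 !mul0mx addr0.
move/eqP: E0; rewrite scaler_eq0 (negPf la_E) /= mulmxBr mul_mx_scalar subr_eq0.
by move/eqP.
Qed.

(** A form of Schur's lemma without an algebraically closed field: W meets the kernel of B - c in a
    submodule, which is nonzero because it contains a highest weight vector, so it is all of W. *)
Lemma simple_eigen x y c W : VV_simple_hw q x y W ->
  (forall u, VV_hw_vector q x y u -> u *m braid_mx = c *: u) -> W *m braid_mx = c *: W.
Proof.
move=> [subW simW [u uW hwu]] eig.
set Kc := kermx (braid_mx - c%:M).
have KcE (n : nat) (A : 'M[K]_(n, 7 * 7)) : (A <= Kc)%MS -> A *m braid_mx = c *: A.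
  by move/sub_kermxP; rewrite mulmxBr mul_mx_scalar => /eqP; rewrite subr_eq0 => /eqP.
have subK : VV_submodule q (W :&: Kc)%MS.
  move=> g; rewrite sub_capmx; apply/andP; split.
    exact: submx_trans (submxMr _ (capmxSl _ _)) (subW g).
  apply: submx_trans (submxMr _ (capmxSr _ _)) _; apply/sub_kermxP.
  have cg : rhoVV q g *m (braid_mx - c%:M) = (braid_mx - c%:M) *m rhoVV q g.
    by rewrite mulmxBr mulmxBl rhoVV_comm scalar_mxC.
  by rewrite -mulmxA cg mulmxA mulmx_ker mul0mx.
have uK : (u <= W :&: Kc)%MS.
  rewrite sub_capmx uW; apply/sub_kermxP.
  by rewrite mulmxBr mul_mx_scalar eig // subrr.
case: (simW _ subK (capmxSl _ _)) => [E|WK].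
  case: hwu => u0 _ _ _ _; case/negP: u0; move: uK.
  by rewrite E submx0.
by apply: KcE; apply: submx_trans WK (capmxSr _ _).
Qed.

(** Directness arrives as an equality of ranks, whereas evaluating [proj_mx] requires each summand
    to meet the sum of the other three trivially. *)
Lemma direct_cap n (X Y Z T : 'M[K]_n) :
  \rank (X + Y + Z + T)%MS = (\rank X + \rank Y + \rank Z + \rank T)%N ->
  [/\ (X :&: (Y + Z + T) = 0)%MS, (Y :&: (X + Z + T) = 0)%MS,
      (Z :&: (X + Y + T) = 0)%MS & (T :&: (X + Y + Z) = 0)%MS].
Proof.
move=> E.
have aux (A B C S : 'M[K]_n) : (A + (B + C + S) :=: X + Y + Z + T)%MS ->
  (\rank A + \rank B + \rank C + \rank S = \rank X + \rank Y + \rank Z + \rank T)%N ->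
  (A :&: (B + C + S) = 0)%MS.
  move=> eq rk; apply/eqP; rewrite -mxrank_eq0.
  have := mxrank_sum_cap A (B + C + S)%MS; rewrite eq E.
  have [l1 _] := mxrank_adds_leqif (B + C)%MS S; have [l2 _] := mxrank_adds_leqif B C.
  lia.
split; apply: aux; try lia.
- by rewrite !addsmxA.
- by rewrite !addsmxA [(Y + X)%MS]addsmxC.
- by rewrite addsmxC -!addsmxA [(T + Z)%MS]addsmxC.
- by rewrite addsmxC.
Qed.

Variable D : VV_decomposition q.

Lemma braid_mx_eigen : [/\ V2l1 D *m braid_mx = q ^+ 2 *: V2l1 D, Vl2 D *m braid_mx = - Vl2 D,
  Vl1 D *m braid_mx = - q ^- 6 *: Vl1 D & Vzero D *m braid_mx = q ^- 12 *: Vzero D].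
Proof.
have e1 : leval q eig_2l1 = q ^+ 2 by rewrite /leval big_seq1 mul1r.
have e2 : leval q eig_l2 = -1 by rewrite /leval big_seq1 /= mulr1.
have e3 : leval q eig_l1 = - q ^- 6 by rewrite /leval big_seq1 mulN1r.
have e4 : leval q eig_0 = q ^- 12 by rewrite /leval big_seq1 mul1r.
split.
- by apply: (simple_eigen (V2l1_simple D)) => u hu; rewrite -e1; apply: hw_eigen hw_check_2l1 hu.
- rewrite -[RHS]scaleN1r.
  by apply: (simple_eigen (Vl2_simple D)) => u hu; rewrite -e2; apply: hw_eigen hw_check_l2 hu.
- by apply: (simple_eigen (Vl1_simple D)) => u hu; rewrite -e3; apply: hw_eigen hw_check_l1 hu.
- by apply: (simple_eigen (Vzero_simple D)) => u hu; rewrite -e4; apply: hw_eigen hw_check_0 hu.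
Qed.

(** Both matrices act by the same scalar on each of the four summands, and these span the whole
    space. *)
Lemma RcheckE : Rcheck D = braid_mx.
Proof.
have [B1 B2 B3 B4] := braid_mx_eigen.
have /mxdirectP /= rk := VV_direct D; have [c1 c2 c3 c4] := direct_cap rk.
have s1 (A B C : 'M[K]_(7 * 7)) : (A <= A + B + C)%MS.
  exact: submx_trans (addsmxSl A B) (addsmxSl _ _).
have s2 (A B C : 'M[K]_(7 * 7)) : (A <= B + A + C)%MS.
  exact: submx_trans (addsmxSr B A) (addsmxSl _ _).
have s3 (A B C : 'M[K]_(7 * 7)) : (A <= B + C + A)%MS by exact: addsmxSr.
suff : (1%:M <= kermx (Rcheck D - braid_mx))%MS.
  by move/sub_kermxP; rewrite mul1mx => /eqP; rewrite subr_eq0 => /eqP.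
rewrite -(VV_full D) !addsmx_sub -!andbA; apply/and4P.
rewrite /Rcheck; split; apply/sub_kermxP;
  rewrite mulmxBr 2!mulmxBr 1!mulmxDr -!scalemxAr.
- rewrite (proj_mx_id c1) // (proj_mx_0 c2) ?(proj_mx_0 c3) ?(proj_mx_0 c4) ?s1 //.
  by rewrite B1 !scaler0 addr0 !subr0 subrr.
- rewrite (proj_mx_id c2) // (proj_mx_0 c1) ?(proj_mx_0 c3) ?(proj_mx_0 c4) ?s1 ?s2 //.
  by rewrite B2 !scaler0 addr0 sub0r subr0 opprK addNr.
- rewrite (proj_mx_id c3) // (proj_mx_0 c1) ?(proj_mx_0 c2) ?(proj_mx_0 c4) ?s2 ?s3 //.
  by rewrite B3 !scaler0 addr0 subr0 sub0r scaleNr subrr.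
- rewrite (proj_mx_id c4) // (proj_mx_0 c1) ?(proj_mx_0 c2) ?(proj_mx_0 c3) ?s3 //.
  by rewrite B4 !scaler0 add0r !subr0 subrr.
Qed.

Lemma braid_lettersE a b : braid_letters D a b = row_malg q row_braid a b.
Proof.
have E : vv a b *m Rcheck D = teval q (word2 vv) (row_braid a b).
  by rewrite RcheckE vv_row_mx_of.
rewrite [RHS](esym (vsum_teval q _ _)) -E /braid_letters /vsum; apply: eq_bigr => c _; apply: eq_bigr => e _.
by rewrite vv_mulE.
Qed.

Lemma wedge_mxE : wedge_mx = braid_mx *m braid_mx - (q ^+ 2 + q ^- 12) *: braid_mx + (q ^- 10)%:M.
Proof.
have row2 a b : sized 2 (row_braid a b).
  by have /andP[] := all_letters (all_letters sized_check a) b.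
apply: eq_mx_vv => a b; rewrite vv_row_mx_of /row_wedge !teval_add (teval_scale q0).
rewrite mulmxDr mulmxBr mulmxA mul_mx_scalar -scalemxAr vv_row_mx_of (teval_row_mx_of q0).
rewrite teval_cons teval_nil addr0 leval_mono addrA; congr (_ + _ + _).
  rewrite !(teval_bind q0) (teval_word2 q _ (row2 a b)) [RHS](teval_word2 q _ (row2 a b)).
  apply: eq_teval => -[|c [|e [|g w]]] //=.
  by rewrite (teval_row_at0 q row2) bind_row.
rewrite -scaleNr; congr (_ *: _); rewrite /leval !big_cons big_nil /= !mulN1r addr0.
by rewrite opprD addrC.
Qed.

(** On an eigenspace of B with eigenvalue c, this matrix acts by (c - q^2)(c - q^-12). For c = -1
    and c = -q^-6 both factors are, up to a unit, of the form 1 + q^n with n nonzero. *)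
Lemma wedge_mx_eigen : [/\ V2l1 D *m wedge_mx = 0, Vzero D *m wedge_mx = 0,
  exists2 c, c != 0 & Vl2 D *m wedge_mx = c *: Vl2 D &
  exists2 c, c != 0 & Vl1 D *m wedge_mx = c *: Vl1 D].
Proof.
have [B1 B2 B3 B4] := braid_mx_eigen.
have qq : q ^- 10 = q ^+ 2 * q ^- 12.
  by field.
have key (c : K) (A : 'M[K]_(7 * 7)) : A *m braid_mx = c *: A ->
  A *m wedge_mx = ((c - q ^+ 2) * (c - q ^- 12)) *: A.
  move=> E; rewrite wedge_mxE mulmxDr mulmxBr mulmxA mul_mx_scalar -scalemxAr E -scalemxAl E.
  rewrite !scalerA -scalerBl -scalerDl qq; congr (_ *: _); ring.
have qneg (n : nat) : q ^- n = q ^ (- n%:Z) by rewrite -exprnN.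
split.
- by rewrite (key _ _ B1) subrr mul0r scale0r.
- by rewrite (key _ _ B4) subrr mulr0 scale0r.
- exists ((-1 - q ^+ 2) * (-1 - q ^- 12)); last by apply: key; rewrite scaleN1r.
  rewrite -!opprD mulrNN qneg; apply: mulf_neq0; [exact: (qD1_neq0 (n := 2))|exact: qD1_neq0].
- exists ((- q ^- 6 - q ^+ 2) * (- q ^- 6 - q ^- 12)); last exact: key.
  have -> : - q ^- 6 - q ^+ 2 = - q ^- 6 * (1 + q ^ 8).
    by rewrite -[q ^ 8]/(q ^+ 8); field.
  have -> : - q ^- 6 - q ^- 12 = - q ^- 6 * (1 + q ^ (- 6%:Z)).
    by rewrite -qneg; field.
  by rewrite !mulf_neq0 ?oppr_eq0 ?invr_eq0 ?expf_neq0 ?qD1_neq0.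
Qed.

Lemma wedge2E : (wedge2 D :=: wedge_mx)%MS.
Proof.
have [C1 C4 [c2 nz2 C2] [c3 nz3 C3]] := wedge_mx_eigen.
apply/eqmxP; apply/andP; split; rewrite /wedge2.
  rewrite addsmx_sub; apply/andP; split.
    by rewrite -(eqmx_scale _ nz2) -C2 submxMl.
  by rewrite -(eqmx_scale _ nz3) -C3 submxMl.
rewrite -[wedge_mx]mul1mx -(eqmxMr _ (VV_full D)) !(addsmxMr, addsmx_sub) C1 C4 C2 C3 !sub0mx /=.
by rewrite !eqmx_scale // addsmxSl addsmxSr.
Qed.

Lemma TV_of_VV_vsum (u : 'rV[K]_(7 * 7)) :
  TV_of_VV u = vsum (fun a b => << FMonom [:: a; b] >> : TV K) u.
Proof. by []. Qed.

Lemma row_wedge2 a b : sized 2 (row_wedge a b).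
Proof. by have /andP[] := all_letters (all_letters sized_check a) b. Qed.

Lemma wedge2_row a b : exists2 u, (u <= wedge2 D)%MS &
  TV_of_VV u = bind (c, e) <- row_malg q row_wedge a b; << FMonom [:: c; e] >>.
Proof.
exists (vv a b *m wedge_mx); first by rewrite wedge2E submxMl.
by rewrite vv_row_mx_of TV_of_VV_vsum vsum_teval bind_row.
Qed.

Lemma vsum_linear (M N : lmodType K) (h : {linear M -> N}) (g : letter -> letter -> M) v :
  h (vsum g v) = vsum (fun a b => h (g a b)) v.
Proof.
have hZ c x : h (c *: x) = c *: h x by rewrite -[c *: x]addr0 linearP linear0 addr0.
rewrite /vsum (big_morph h (raddfD h) (raddf0 h)); apply: eq_bigr => a _.
by rewrite (big_morph h (raddfD h) (raddf0 h)); apply: eq_bigr => b _; apply: hZ.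
Qed.

Lemma wedge2_span u : (u <= wedge2 D)%MS -> exists x, TV_of_VV u =
  bind (a, b) <- x; bind (c, e) <- row_malg q row_wedge a b; << FMonom [:: c; e] >>.
Proof.
rewrite wedge2E => /submxP[v ->]; exists (vsum (fun a b => << (a, b) >>) v).
rewrite TV_of_VV_vsum -{1}[v]vsum_id.
have -> : vsum vv v *m wedge_mx = vsum (fun a b => vv a b *m wedge_mx) v.
  rewrite /vsum mulmx_suml; apply: eq_bigr => a _.
  by rewrite mulmx_suml; apply: eq_bigr => b _; rewrite scalemxAl.
rewrite [LHS](vsum_linear (vsum _)) [RHS](vsum_linear (lin _)).
apply: eq_bigr => a _; apply: eq_bigr => b _; congr (_ *: _).
rewrite [RHS]linU /= vv_row_mx_of.
apply: etrans (vsum_teval q _ _) _; rewrite [RHS]bind_row //.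
Qed.

End Rcheck.

(** * The invariants *)

Lemma gamma_sized : all (fun c => sized 2 (row_gamma c)) letters.
Proof. by vm_compute. Qed.

Section Assembly.
Variables (K : fieldType) (q : K).
Hypothesis q0 : q != 0.
Hypothesis q_inf : forall n : int, q ^ n = 1 -> n = 0.
Variable D : VV_decomposition q.
Local Notation rmul := (rmul D).
Local Notation chain := (chain D).

Let BL_nat : braid_natural D (braid_letters D).
Proof. by apply: (braid_letters_natural q0) => a b; apply: (braid_lettersE q0 q_inf). Qed.

Let mulE m (x y : TVm K m) : Am_of D x *q Am_of D y = Am_of D (TVm_mul D x y).
Proof.
apply: (Am_mulE (CL := row_malg q row_wedge)).
- by apply: (wedge_natural q0) => a b; apply: (braid_lettersE q0 q_inf).
- by move=> a b; apply: (wedge2_row q0 q_inf).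
- move=> u uW; exact (wedge2_span q0 q_inf uW).
Qed.

Lemma Am_of_linear m : linear (@Am_of _ _ D m).
Proof. by move=> a x y; rewrite Am_ofD -Am_scaleE. Qed.

Definition word_chain m (ps : seq nat) (w : seq letter) : Am D m :=
  Am_of D (chain ps w (mword_one m)).

Definition invariant m (ps : seq nat) (T : tensor) : Am D m := teval q (word_chain m ps) T.

Lemma invariantE m ps T :
  invariant m ps T = Am_of D (teval q (fun w => chain ps w (mword_one m)) T).
Proof. by rewrite (teval_linear q _ _ (@Am_of_linear m)). Qed.

Lemma invariant_braids m ks ps T : descents ks ps ->
  invariant m ps T = invariant m (swaps ks ps) (braids ks T).
Proof.
move=> des; rewrite !invariantE; congr Am_of; apply: (chain_braids BL_nat q0) => //.
- exact: (braid_lettersE q0 q_inf).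
- by move=> a b; have /andP[] := all_letters (all_letters sized_check a) b.
Qed.

Fixpoint lword m (ps : seq nat) (w : seq letter) : mword m :=
  match ps, w with
  | p :: ps', a :: w' => lcons p a (lword m ps' w')
  | _, _ => mword_one m
  end.

Lemma low_lword m p ps w : all (leq p) ps -> low p (lword m ps w).
Proof.
elim: ps w => [|p' ps IH] [|a w] /=; rewrite ?low_one //.
by case/andP=> le_p all_p; apply: low_lcons => //; apply: IH.
Qed.

Lemma chain_lcons m p a ps w (u : mword m) (M : lmodType K) (F : mword m -> M) :
  all (leq p) ps -> size ps = size w ->
  lin F (chain ps w (lcons p a u)) = bind v <- chain ps w u; F (lcons p a v).
Proof.
elim: ps w u => [|p' ps IH] [|b w] u //=.
  by move=> _ _; rewrite [LHS]linU [RHS]linU.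
case/andP=> le_p all_p [sz]; rewrite [LHS]lin_lin [RHS]lin_lin.
rewrite [LHS]rmul_lcons //; apply: eq_lin => v; exact: IH.
Qed.

(** In weakly increasing order each generator is appended without crossing any letter, so the
    product is a single basis element. *)
Lemma chain_lword m ps w : sorted leq ps -> all (fun p => p < m)%N ps ->
  size ps = size w -> chain ps w (mword_one m) = << lword m ps w >>.
Proof.
elim: ps w => [|p ps IH] [|a w] //= srt /andP[lt_p all_p] [sz].
have all_le : all (leq p) ps by apply: order_path_min srt => x y z; apply: leq_trans.
rewrite [LHS]rmul_one // -[LHS]malg_sum [LHS]chain_lcons //.
by rewrite IH ?(path_sorted srt) // [LHS]linU.
Qed.

Lemma mword_mul_lword m ps w u (M : lmodType K) (F : mword m -> M) :
  sorted leq ps -> all (fun p => p < m)%N ps -> size ps = size w ->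
  lin F (mword_mul D u (lword m ps w)) = lin F (chain ps w u).
Proof.
elim: ps w u => [|p ps IH] [|a w] u //= srt.
  by move=> _ _; rewrite [LHS]mword_mul_one [RHS]linU.
case/andP=> lt_p all_p [sz].
have all_le : all (leq p) ps by apply: order_path_min srt => x y z; apply: leq_trans.
rewrite [LHS]mword_mul_lcons ?low_lword // [RHS]lin_lin; apply: eq_lin => v.
by apply: IH; rewrite ?(path_sorted srt).
Qed.

Lemma TVm_mul_chain m ps w (x : TVm K m) :
  sorted leq ps -> all (fun p => p < m)%N ps -> size ps = size w ->
  TVm_mul D x (chain ps w (mword_one m)) = lin (chain ps w) x.
Proof.
move=> srt all_p sz; rewrite /TVm_mul /lin2; apply: eq_lin => u.
rewrite chain_lword // [LHS]linU -[LHS]malg_sum -[RHS]malg_sum.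
exact: mword_mul_lword.
Qed.

(** Only the right factor has to be in order. In the products defining [Phi] and [Psi] every right
    factor is a single generator, so these expand for any positions. *)
Lemma word_chainM m ps ps' w w' : size ps = size w -> size ps' = size w' ->
  sorted leq ps' -> all (fun p => p < m)%N ps' ->
  word_chain m ps w *q word_chain m ps' w' = word_chain m (ps ++ ps') (w ++ w').
Proof.
move=> sz sz' srt all_p; rewrite /word_chain mulE TVm_mul_chain //.
by rewrite chain_cat.
Qed.

Lemma X_chain m (i : 'I_m) a : X D i a = word_chain m [:: val i] [:: a].
Proof.
rewrite /X /word_chain /= mword_X_lcons; congr Am_of.
by rewrite [RHS]rmul_one.
Qed.

Lemma Am_mul_linl m (y : Am D m) : linear (fun x => x *q y).
Proof.
move=> a x x'; rewrite -[x]Am_repr -[x']Am_repr -[y]Am_repr.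
by rewrite -Am_of_linear !mulE -Am_of_linear (TVm_mul_linl D).
Qed.

Lemma Am_mul_linr m (x : Am D m) : linear (fun y => x *q y).
Proof.
move=> a y y'; rewrite -[x]Am_repr -[y]Am_repr -[y']Am_repr.
by rewrite -Am_of_linear !mulE -Am_of_linear (TVm_mul_linr D).
Qed.

Lemma invariantM m ps ps' T S : sized (size ps) T -> sized (size ps') S ->
  sorted leq ps' -> all (fun p => p < m)%N ps' ->
  invariant m ps T *q invariant m ps' S = invariant m (ps ++ ps') (tprod T S).
Proof.
move=> sT sS srt all_p; rewrite (teval_linear q _ _ (Am_mul_linl _)).
rewrite /invariant {1 3}/teval /tprod big_allpairs_dep /=.
elim: T sT => [|[w p] T IH]; first by rewrite !big_nil.
rewrite !big_cons => /andP[/= /eqP sw sT]; rewrite IH //; congr (_ + _).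
rewrite (teval_linear q _ _ (Am_mul_linr _)) /teval scaler_sumr.
elim: S sS {IH} => [|[w' r] S IH]; first by rewrite !big_nil.
rewrite !big_cons => /andP[/= /eqP sw' sS]; rewrite IH //; congr (_ + _).
by rewrite (leval_mul q0) scalerA word_chainM.
Qed.

Definition delta_sum (M : lmodType K) (f : letter -> letter -> M) (A : 'M[K]_7) : M :=
  \sum_a \sum_b A a b *: f a b.

Lemma phi_sum (M : lmodType K) (f : letter -> letter -> M) :
  delta_sum f (phi q) = teval q (word2 f) tab_phi.
Proof.
have dD A B : delta_sum f (A + B) = delta_sum f A + delta_sum f B.
  rewrite /delta_sum -big_split; apply: eq_bigr => a _; rewrite -big_split.
  by apply: eq_bigr => b _; rewrite mxE scalerDl.
have dZ c x y : delta_sum f (c *: delta_mx x y) = c *: f x y.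
  rewrite /delta_sum (bigD1 x) //= (bigD1 y) //= !mxE !eqxx mulr1 !big1 ?addr0 //.
    move=> a ax; apply: big1 => b _; by rewrite !mxE (negPf ax) mulr0 scale0r.
  by move=> b bx; rewrite !mxE (negPf bx) andbF mulr0 scale0r.
have d1 x y : delta_sum f (delta_mx x y) = f x y by rewrite -[delta_mx x y]scale1r dZ scale1r.
rewrite /phi !dD !dZ !d1 /tab_phi !teval_cons teval_nil /=.
have l1 e : leval q [:: (e, Zpos xH)] = q ^ int_of_Z e by rewrite /leval big_seq1 mul1r.
rewrite !l1 !expr0z !scale1r addr0 !addrA.
(* [phi] lists opposite pairs of letters together, [tab_phi] lists words in lexicographic order. *)
by rewrite [LHS](ACl (1*3*5*7*6*4*2))%AC.
Qed.

Lemma Phi_invariant m (i j : 'I_m) : Phi D i j = invariant m [:: val i; val j] tab_phi.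
Proof.
transitivity (delta_sum (fun a b => word_chain m [:: val i; val j] [:: a; b]) (phi q)).
  apply: eq_bigr => a _; apply: eq_bigr => b _; congr (_ *: _).
  by rewrite !X_chain word_chainM //= ltn_ord.
by rewrite phi_sum -teval_word2.
Qed.

Variable gamma : 'M[K]_(7, 7 * 7).
Hypothesis gammaP : is_gamma q gamma.

Lemma row_gammaE a : row a gamma = teval q (word2 (@vv K)) (row_gamma a).
Proof.
have [comm r1] := gammaP.
have act g T : teval q (word2 (@vv K)) T *m rhoVV q g = teval q (word2 (@vv K)) (act2 g T).
  have -> : rhoVV q g = row_mx_of q (row_rho2 g).
    by apply: eq_mx_vv => x y; rewrite (row_rho2E q0) vv_row_mx_of.
  by rewrite (teval_row_mx_of q0).
have opp T : teval q (word2 (@vv K)) (topp T) = - teval q (word2 (@vv K)) T.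
  by rewrite (teval_scale q0) /leval big_seq1 /= expr0z mulr1 scaleN1r.
have lN1 : leval q (lopp (lmono Z0)) = -1 by rewrite /leval big_seq1 /= expr0z mulr1.
(* Equivariance read at row x, when [g] sends v_x to v_y; [stepN] is the variant with v_x sent to
   -v_y. *)
have step g x y T : row_rho g x = [:: ([:: y], lmono Z0)] ->
    row x gamma = teval q (word2 (@vv K)) T ->
    row y gamma = teval q (word2 (@vv K)) (act2 g T).
  by move=> rE E; rewrite -act -E !rowE -mulmxA -comm mulmxA row_rhoE rE teval_one.
have stepN g x y T : row_rho g x = [:: ([:: y], lopp (lmono Z0))] ->
    row x gamma = teval q (word2 (@vv K)) T ->
    row y gamma = teval q (word2 (@vv K)) (topp (act2 g T)).
  move=> rE E; rewrite opp -act -E !rowE -mulmxA -comm mulmxA row_rhoE rE.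
  by rewrite teval_cons teval_nil lN1 addr0 scaleN1r mulNmx opprK.
have g1 : row v1 gamma = teval q (word2 (@vv K)) gamma_v1.
  rewrite r1 /gamma_v1 !teval_cons teval_nil leval_mono expr0z scale1r addr0 /=.
  have -> : leval q [:: (Zneg 3, Zneg 1); (Zneg 1, Zneg 1)] = - (q ^- 3 + q^-1).
    by rewrite /leval !big_cons big_nil !mulN1r addr0 opprD.
  have -> : leval q [:: (Zneg 6, Zpos 1); (Zneg 4, Zpos 1)] = (q ^- 3 + q^-1) * q ^- 3.
    rewrite /leval !big_cons big_nil !mul1r addr0 mulrDl.
    by rewrite -[q ^ int_of_Z (Zneg 6)]/(q ^- 6) -[q ^ int_of_Z (Zneg 4)]/(q ^- 4); field.
  have -> : leval q [:: (Zneg 6, Zneg 1)] = - q ^- 6 by rewrite /leval big_seq1 mulN1r.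
  by rewrite scalerBr scalerA opprB !scaleNr addrAC -!addrA; congr (_ + _); rewrite addrCA.
have g2 := step F1 v1 v2 _ erefl g1.
have g3 := step F2 v2 v3 _ erefl g2.
have g0 := step F1 v3 v0 _ erefl g3.
have gm3 := stepN F1 v0 vm3 _ erefl g0.
have gm2 := stepN F2 vm3 vm2 _ erefl gm3.
have gm1 := stepN F1 vm2 vm1 _ erefl gm2.
by elim/letter_ind7: a.
Qed.

Lemma Psi_invariant m (i j k : 'I_m) :
  Psi D gamma i j k = invariant m [:: val i; val j; val k] tab_psi.
Proof.
set f := word_chain m [:: val i; val j; val k].
rewrite /invariant -/f /tab_psi (teval_bind q0) (teval_scale q0).
have g2 c : sized 2 (row_gamma c) by apply: (all_letters gamma_sized).
have -> : teval q (fun w => teval q f (if w is [:: r; c]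
    then [seq (r :: x.1, x.2) | x <- row_gamma c] else [::])) tab_phi =
  delta_sum (fun r c => vsum (fun s t => f [:: r; s; t]) (row c gamma)) (phi q).
  rewrite phi_sum; apply: eq_teval => -[|r [|c [|e w]]] /=; rewrite ?teval_nil //.
  rewrite row_gammaE vsum_teval -[RHS](teval_word2 q (fun w => f (r :: w)) (g2 c)).
  by rewrite /teval big_map.
have -> : leval q [:: (Zpos 3, Zneg 1)] = - q ^+ 3 by rewrite /leval big_seq1 mulN1r.
rewrite /delta_sum scaler_sumr; apply: eq_bigr => r _; rewrite scaler_sumr.
transitivity (\sum_s \sum_t \sum_c
    (- q ^+ 3 * (phi q r c * gamma c (mxtens_index (s, t)))) *: f [:: r; s; t]).
  apply: eq_bigr => s _; apply: eq_bigr => t _.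
  rewrite /psi_coef mulr_sumr scaler_suml; apply: eq_bigr => c _; congr (_ *: _).
  by rewrite !X_chain !word_chainM //= ltn_ord.
apply/esym; under eq_bigr => c _.
  rewrite /vsum scalerA scaler_sumr; under eq_bigr => s _ do rewrite scaler_sumr.
  over.
rewrite exchange_big; apply: eq_bigr => s _; rewrite exchange_big.
apply: eq_bigr => t _; apply: eq_bigr => c _.
by rewrite [row c gamma _ _]mxE scalerA mulrA.
Qed.

Lemma tab_phi_sized : sized 2 tab_phi. Proof. by vm_compute. Qed.
Lemma tab_psi_sized : sized 3 tab_psi. Proof. by vm_compute. Qed.

Lemma PhiPsi_invariant m (i j r s t : 'I_m) : (r < s < t)%N ->
  Phi D i j *q Psi D gamma r s t =
  invariant m [:: val i; val j; val r; val s; val t] phipsi.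
Proof.
move=> rst; rewrite Phi_invariant Psi_invariant.
have srt : sorted leq [:: val r; val s; val t] by rewrite /=; lia.
have lt_m : all (fun p => p < m)%N [:: val r; val s; val t] by rewrite /= !ltn_ord.
exact (@invariantM m [:: val i; val j] [:: val r; val s; val t] _ _ tab_phi_sized tab_psi_sized srt lt_m).
Qed.

Lemma PsiPhi_invariant m (i j r s t : 'I_m) : (i <= j)%N ->
  Psi D gamma r s t *q Phi D i j =
  invariant m [:: val r; val s; val t; val i; val j] psiphi.
Proof.
move=> ij; rewrite Phi_invariant Psi_invariant.
have srt : sorted leq [:: val i; val j] by rewrite /= ij.
have lt_m : all (fun p => p < m)%N [:: val i; val j] by rewrite /= !ltn_ord.
exact (@invariantM m [:: val r; val s; val t] [:: val i; val j] _ _ tab_psi_sized tab_phi_sized srt lt_m).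
Qed.

(** Both products are brought to the same ordered positions, after which it is enough that the two
    tensors in V^{(x) 5} agree. *)
Lemma invariant_comm m ks ks' ps ps' : descents ks ps -> descents ks' ps' ->
  swaps ks ps = swaps ks' ps' -> teq (braids ks phipsi) (braids ks' psiphi) ->
  invariant m ps phipsi = invariant m ps' psiphi.
Proof.
move=> des des' E chk; rewrite (invariant_braids m _ des) (invariant_braids m _ des') E.
exact: (teval_teq q0).
Qed.

(** These hold because an invariant tensor crosses any strand unchanged. In the first four cases phi
    crosses legs of psi, and both sides become phi inserted before, inside or after psi; in the last
    case psi crosses one leg of phi, and both sides become psi inserted between the two legs. The
    lists of swaps realise these crossings. *)
Lemma Phi_Psi_comm m (i j r s t : 'I_m) : (i <= j)%N -> (r < s < t)%N ->
  [\/ (j < r)%N, (r < i)%N && (j < s)%N, (s < i)%N && (j < t)%N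
     | (t < i)%N \/ (i < r)%N && (t < j)%N] ->
  Phi D i j *q Psi D gamma r s t = Psi D gamma r s t *q Phi D i j.
Proof.
move=> ij rst; rewrite (PhiPsi_invariant i j rst) (PsiPhi_invariant r s t ij).
case=> [jr|ris|sit|[ti|irj]].
- apply: (@invariant_comm m [::] [:: 2; 1; 0; 3; 2; 1]%N); [by []|rewrite /=; lia|by []|by vm_compute].
- apply: (@invariant_comm m [:: 1; 0]%N [:: 2; 1; 3; 2]%N); [rewrite /=; lia|rewrite /=; lia|by []|by vm_compute].
- apply: (@invariant_comm m [:: 1; 0; 2; 1]%N [:: 2; 3]%N); [rewrite /=; lia|rewrite /=; lia|by []|by vm_compute].
- apply: (@invariant_comm m [:: 1; 0; 2; 1; 3; 2]%N [::]); [rewrite /=; lia|by []|by []|by vm_compute].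
- apply: (@invariant_comm m [:: 1; 2; 3]%N [:: 2; 1; 0]%N); [rewrite /=; lia|rewrite /=; lia|by []|by vm_compute].
Qed.

(** * Reduction to the positions 0, ..., 4 *)

Section Ranks.
Variable pos : nat -> nat.
Hypothesis pos_lt : forall x y, (x < y)%N -> (pos x < pos y)%N.

Lemma swap_at_map k ps : swap_at k (map pos ps) = map pos (swap_at k ps).
Proof.
elim: k ps => [|k IH] [|p ps] //=; last by rewrite IH.
by case: ps.
Qed.

Lemma descent_map k ps : descent k ps -> descent k (map pos ps).
Proof.
elim: k ps => [|k IH] [|p ps] //=; last exact: IH.
by case: ps => //= p' ps; apply: pos_lt.
Qed.

(** Which crossings occur depends only on the relative order of the positions, so sorting can be
    computed on ranks and transported along [pos]. *)
Lemma invariant_braids_map m ks ps T : descents ks ps ->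
  invariant m (map pos ps) T = invariant m (map pos (swaps ks ps)) (braids ks T).
Proof.
have swapsE : swaps ks (map pos ps) = map pos (swaps ks ps).
  by rewrite /swaps; elim: ks ps => //= k ks IH ps; rewrite swap_at_map IH.
move=> des; rewrite (@invariant_braids m ks) ?swapsE //.
elim: ks ps des {swapsE} => //= k ks IH ps /andP[des dess].
by rewrite descent_map //= swap_at_map IH.
Qed.
End Ranks.

(* Insertion sort, recording the positions of the adjacent transpositions. *)
Fixpoint insert_swaps (k : nat) (p : nat) (ps : seq nat) : seq nat :=
  if ps is p' :: ps' then
    if (p < p')%N then k :: insert_swaps k.-1 p ps' else [::]
  else [::].

(** [acc] holds the positions already placed, largest first, so that the entry at index k meets its
    left neighbour first, by the swap at [k.-1]. For k = 0 the truncated predecessor does not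
    matter, as [acc] is empty. *)
Fixpoint sort_swaps_rec (k : nat) (acc ps : seq nat) : seq nat :=
  if ps is p :: ps' then
    insert_swaps k.-1 p acc ++
      sort_swaps_rec k.+1 (rev (sort leq (p :: acc))) ps'
  else [::].
Definition sort_swaps := sort_swaps_rec 0 [::].

(** Replaces a correctness proof of the sorting routine: its output is tested on each list that is
    used. *)
Definition sorts (ps : seq nat) : bool :=
  descents (sort_swaps ps) ps && (swaps (sort_swaps ps) ps == iota 0 5).

Definition normal (ps : seq nat) (T : tensor) : tensor := braids (sort_swaps ps) T.

Definition lin_comb (cs : seq (laurent * tensor)) : tensor :=
  foldr (fun x S => tadd (tscale x.1 x.2) S) [::] cs.

Definition lmono_q := lmono (Zpos 1).
Definition lmono_qV := lmono (Zneg 1).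
Definition lbracket_diff : laurent := [:: (Zneg 1, Zneg 1); (Zpos 1, Zpos 1)].
Definition lcoef_long : laurent := lmul lbracket_diff [:: (Zneg 2, Zpos 1); (Zpos 2, Zpos 1)].

(** The lists give the positions in the eight products of a relation, in the order in which they
    occur, with 0, ..., 4 standing for i, j, r, s, t. [A] and [C] belong to products of the form Psi
    Phi, the others to Phi Psi. *)
Definition relation_check (A B C E F G H I : seq nat) : bool :=
  all sorts [:: A; B; C; E; F; G; H; I] &&
  teq (lin_comb [:: (lmono_qV, normal A psiphi); (lopp lmono_q, normal B phipsi);
         (lmono_q, normal C psiphi); (lopp lmono_qV, normal E phipsi)])
      (lin_comb [:: (lbracket_diff, normal F phipsi); (lopp lbracket_diff, normal G phipsi);
         (lcoef_long, normal H phipsi); (lopp lcoef_long, normal I phipsi)]).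

Lemma relation_lin (M : lmodType K) (f : seq letter -> M) A B C E F G H I :
  teq (lin_comb [:: (lmono_qV, A); (lopp lmono_q, B); (lmono_q, C); (lopp lmono_qV, E)])
      (lin_comb [:: (lbracket_diff, F); (lopp lbracket_diff, G); (lcoef_long, H); (lopp lcoef_long, I)]) ->
  let e := teval q f in
  q^-1 *: e A - q *: e B + q *: e C - q^-1 *: e E =
  (q - q^-1) *: (e F - e G) + ((q - q^-1) * (q ^+ 2 + q ^- 2)) *: (e H - e I).
Proof.
move/(teval_teq q0 f) => chk e.
have comb cs : teval q f (lin_comb cs) = \sum_(x <- cs) leval q x.1 *: e x.2.
  elim: cs => [|x cs IH] /=; first by rewrite teval_nil big_nil.
  by rewrite teval_add (teval_scale q0) IH big_cons.
have e1 : leval q lmono_q = q by rewrite /leval big_seq1 mul1r.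
have eV : leval q lmono_qV = q^-1 by rewrite /leval big_seq1 mul1r.
have eB : leval q lbracket_diff = q - q^-1.
  by rewrite /leval !big_cons big_nil mulN1r mul1r addr0 addrC.
have eC : leval q lcoef_long = (q - q^-1) * (q ^+ 2 + q ^- 2).
  rewrite (leval_mul q0) eB; congr (_ * _).
  by rewrite /leval !big_cons big_nil !mul1r addr0 addrC.
have oE p : leval q (lopp p) = - leval q p.
  rewrite /leval /lopp big_map -sumrN; apply: eq_bigr => x _ /=.
  by rewrite -[Z.opp _]/(- x.2) rmorphN rmorphN mulNr.
move: chk; rewrite !comb !big_cons !big_nil; cbn [fst snd]; rewrite !oE e1 eV eB eC !scaleNr !addr0.
by rewrite !scalerBr !addrA.
Qed.

Lemma relation_invariant m pos A B C E F G H I :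
  (forall x y, (x < y)%N -> (pos x < pos y)%N) -> relation_check A B C E F G H I ->
  let PsPh ps := invariant m (map pos ps) psiphi in
  let PhPs ps := invariant m (map pos ps) phipsi in
  q^-1 *: PsPh A - q *: PhPs B + q *: PsPh C - q^-1 *: PhPs E =
  (q - q^-1) *: (PhPs F - PhPs G)
  + ((q - q^-1) * (q ^+ 2 + q ^- 2)) *: (PhPs H - PhPs I).
Proof.
move=> pos_lt /andP[/and5P[sA sB sC sE /and5P[sF sG sH sI _]] chk] PsPh PhPs.
have N ps T : sorts ps ->
    invariant m (map pos ps) T = invariant m (map pos (iota 0 5)) (normal ps T).
  by case/andP=> des /eqP Eps; rewrite (invariant_braids_map pos_lt m T des) Eps.
rewrite /PsPh /PhPs (N A) ?(N B) ?(N C) ?(N E) ?(N F) ?(N G) ?(N H) ?(N I);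
  [|assumption..].
exact: relation_lin.
Qed.

Lemma relation1 : relation_check
  [:: 0; 1; 3; 2; 4]%N [:: 2; 4; 0; 1; 3]%N [:: 0; 2; 3; 1; 4]%N [:: 1; 4; 0; 2; 3]%N
  [:: 3; 4; 0; 1; 2]%N [:: 0; 4; 1; 2; 3]%N [:: 0; 1; 2; 3; 4]%N [:: 2; 3; 0; 1; 4]%N.
Proof. by vm_compute. Qed.

Lemma relation2 : relation_check
  [:: 0; 2; 3; 1; 4]%N [:: 1; 4; 0; 2; 3]%N [:: 0; 2; 4; 1; 3]%N [:: 1; 3; 0; 2; 4]%N
  [:: 0; 1; 2; 3; 4]%N [:: 1; 2; 0; 3; 4]%N [:: 2; 3; 0; 1; 4]%N [:: 0; 4; 1; 2; 3]%N.
Proof. by vm_compute. Qed.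

Lemma relation3 : relation_check
  [:: 0; 2; 4; 1; 3]%N [:: 1; 3; 0; 2; 4]%N [:: 1; 2; 4; 0; 3]%N [:: 0; 3; 1; 2; 4]%N
  [:: 2; 3; 0; 1; 4]%N [:: 3; 4; 0; 1; 2]%N [:: 0; 4; 1; 2; 3]%N [:: 1; 2; 0; 3; 4]%N.
Proof. by vm_compute. Qed.

Lemma relation4 : relation_check
  [:: 1; 2; 4; 0; 3]%N [:: 0; 3; 1; 2; 4]%N [:: 1; 3; 4; 0; 2]%N [:: 0; 2; 1; 3; 4]%N
  [:: 0; 4; 1; 2; 3]%N [:: 0; 1; 2; 3; 4]%N [:: 1; 2; 0; 3; 4]%N [:: 3; 4; 0; 1; 2]%N.
Proof. by vm_compute. Qed.

Lemma Phi_Psi_relations m (i j r s t : 'I_m) :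
  (i < j)%N -> (j < r)%N -> (r < s)%N -> (s < t)%N ->
  let Phi (a b : 'I_m) : Am D m := Phi D a b in
  let Psi (a b c : 'I_m) : Am D m := Psi D gamma a b c in
  [/\ q^-1 *: (Psi i j s *q Phi r t) - q *: (Phi r t *q Psi i j s)
      + q *: (Psi i r s *q Phi j t) - q^-1 *: (Phi j t *q Psi i r s)
      = (q - q^-1) *: (Phi s t *q Psi i j r - Phi i t *q Psi j r s)
      + ((q - q^-1) * (q ^+ 2 + q ^- 2)) *:
          (Phi i j *q Psi r s t - Phi r s *q Psi i j t),
      q^-1 *: (Psi i r s *q Phi j t) - q *: (Phi j t *q Psi i r s)
      + q *: (Psi i r t *q Phi j s) - q^-1 *: (Phi j s *q Psi i r t)
      = (q - q^-1) *: (Phi i j *q Psi r s t - Phi j r *q Psi i s t)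
      + ((q - q^-1) * (q ^+ 2 + q ^- 2)) *:
          (Phi r s *q Psi i j t - Phi i t *q Psi j r s),
      q^-1 *: (Psi i r t *q Phi j s) - q *: (Phi j s *q Psi i r t)
      + q *: (Psi j r t *q Phi i s) - q^-1 *: (Phi i s *q Psi j r t)
      = (q - q^-1) *: (Phi r s *q Psi i j t - Phi s t *q Psi i j r)
      + ((q - q^-1) * (q ^+ 2 + q ^- 2)) *:
          (Phi i t *q Psi j r s - Phi j r *q Psi i s t)
    & q^-1 *: (Psi j r t *q Phi i s) - q *: (Phi i s *q Psi j r t)
      + q *: (Psi j s t *q Phi i r) - q^-1 *: (Phi i r *q Psi j s t)
      = (q - q^-1) *: (Phi i t *q Psi j r s - Phi i j *q Psi r s t)
      + ((q - q^-1) * (q ^+ 2 + q ^- 2)) *: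
          (Phi j r *q Psi i s t - Phi s t *q Psi i j r)].
Proof.
move=> ij jr rs st Ph Ps.
(* The default [t + x] keeps [pos] strictly increasing beyond the five ranks, as its monotonicity is
   required on all of nat. *)
pose pos x := nth (t + x)%N [:: val i; val j; val r; val s; val t] x.
have pos_lt x y : (x < y)%N -> (pos x < pos y)%N.
  by rewrite /pos; case: x => [|[|[|[|[|x]]]]]; case: y => [|[|[|[|[|y]]]]] /=; rewrite ?nth_nil; lia.
have PhPs (a b x y z : 'I_m) : (x < y < z)%N ->
    Ph a b *q Ps x y z = invariant m [:: val a; val b; val x; val y; val z] phipsi.
  exact: PhiPsi_invariant.
have PsPh (a b x y z : 'I_m) : (a <= b)%N ->
    Ps x y z *q Ph a b = invariant m [:: val x; val y; val z; val a; val b] psiphi.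
  exact: PsiPhi_invariant.
clearbody Ph Ps; rewrite !PhPs ?PsPh; [|lia..].
split.
- exact: (relation_invariant m pos_lt relation1).
- exact: (relation_invariant m pos_lt relation2).
- exact: (relation_invariant m pos_lt relation3).
- exact: (relation_invariant m pos_lt relation4).
Qed.

End Assembly.

(** * The indeterminate of C(q) and the final assembly *)

Lemma tofracX_neq0 (R : realType) : @Defs.q R != 0.
Proof. by rewrite /Defs.q tofrac_eq0 polyX_eq0. Qed.

(** The power descends to an equality of polynomials, where degrees decide. *)
Lemma tofracX_exp (R : realType) (n : nat) : (@Defs.q R) ^+ n = 1 -> n = 0%N.
Proof.
move/eqP; rewrite /Defs.q -rmorphXn -tofrac1 tofrac_eq => /eqP E.
by have := size_polyXn (R[i]) n; rewrite E size_poly1 => -[].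
Qed.

Lemma tofracX_exprz (R : realType) (n : int) : (@Defs.q R) ^ n = 1 -> n = 0.
Proof.
case: n => n; first by move/tofracX_exp=> ->.
by rewrite NegzE -invr_expz => /(congr1 GRing.inv); rewrite invrK invr1 => /tofracX_exp.
Qed.

Theorem lemma5p15 (R : realType) (D : VV_decomposition (@q R))
    (gamma : 'M[Cq R]_(7, 7 * 7)) (gammaP : is_gamma q gamma)
    (m : nat) (i j r s t : 'I_m) (ij : (i <= j)%N) (rst : (r < s < t)%N) :
  let Phi (a b : 'I_m) : Am D m := Phi D a b in
  let Psi (a b c : 'I_m) : Am D m := Psi D gamma a b c in
  [/\ (i != r -> i != s -> i != t ->
        Phi i i *q Psi r s t = Psi r s t *q Phi i i),
      ([\/ (j < r)%N, (r < i)%N && (j < s)%N, (s < i)%N && (j < t)%N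
         | (t < i)%N \/ (i < r)%N && (t < j)%N] ->
        Phi i j *q Psi r s t = Psi r s t *q Phi i j)
    & ((i < j < r)%N ->
      [/\ q^-1 *: (Psi i j s *q Phi r t) - q *: (Phi r t *q Psi i j s)
          + q *: (Psi i r s *q Phi j t) - q^-1 *: (Phi j t *q Psi i r s)
          = (q - q^-1) *: (Phi s t *q Psi i j r - Phi i t *q Psi j r s)
          + ((q - q^-1) * (q ^+ 2 + q ^- 2)) *:
              (Phi i j *q Psi r s t - Phi r s *q Psi i j t),
          q^-1 *: (Psi i r s *q Phi j t) - q *: (Phi j t *q Psi i r s)
          + q *: (Psi i r t *q Phi j s) - q^-1 *: (Phi j s *q Psi i r t)
          = (q - q^-1) *: (Phi i j *q Psi r s t - Phi j r *q Psi i s t)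
          + ((q - q^-1) * (q ^+ 2 + q ^- 2)) *:
              (Phi r s *q Psi i j t - Phi i t *q Psi j r s),
          q^-1 *: (Psi i r t *q Phi j s) - q *: (Phi j s *q Psi i r t)
          + q *: (Psi j r t *q Phi i s) - q^-1 *: (Phi i s *q Psi j r t)
          = (q - q^-1) *: (Phi r s *q Psi i j t - Phi s t *q Psi i j r)
          + ((q - q^-1) * (q ^+ 2 + q ^- 2)) *:
              (Phi i t *q Psi j r s - Phi j r *q Psi i s t)
        & q^-1 *: (Psi j r t *q Phi i s) - q *: (Phi i s *q Psi j r t)
          + q *: (Psi j s t *q Phi i r) - q^-1 *: (Phi i r *q Psi j s t)
          = (q - q^-1) *: (Phi i t *q Psi j r s - Phi i j *q Psi r s t)
          + ((q - q^-1) * (q ^+ 2 + q ^- 2)) *: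
              (Phi j r *q Psi i s t - Phi s t *q Psi i j r)])].
Proof.
have q0 := tofracX_neq0 R; have q_inf := @tofracX_exprz R.
have comm := Phi_Psi_comm q0 q_inf D gammaP.
split.
- move=> ir is' it; apply: comm => //; case/andP: rst => lt_rs lt_st.
  (* An index different from r, s and t lies in one of the four gaps they leave, which are the first
     four cases of (2) with j = i. *)
  case: (ltngtP i r) ir => [lt_ir _|lt_ri _|/val_inj-> /eqP//]; first by constructor 1.
  case: (ltngtP i s) is' => [lt_is _|lt_si _|/val_inj-> /eqP//].
    by constructor 2; lia.
  case: (ltngtP i t) it => [lt_it _|lt_ti _|/val_inj-> /eqP//].
    by constructor 3; lia.
  by constructor 4; left.
- exact: comm.
- case/andP=> lt_ij lt_jr; case/andP: rst => lt_rs lt_st.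
  exact: (Phi_Psi_relations q0 q_inf D gammaP).
Qed.
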